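(* Let $(\mathcal{M},\theta)$ be a compact metric space with a Borel probability measure $\mu$, and let $\mathcal{R}_N$ be an equal-measure partition of $\mathcal{M}$ into $N$ parts. Then the following hold. (i) If a metric $\rho$ on $\mathcal{M}$ satisfies $\rho(x_1,x_2)\le c_0\,\theta(x_1,x_2)$ for all $x_1,x_2\in\mathcal{M}$, with a constant $c_0>0$, then $$\rho_N\ \ge\ \langle\rho\rangle N^2-c_0\,\mathrm{Diam}_1(\mathcal{R}_N,\theta)N\ \ge\ \langle\rho\rangle N^2-c_0\,\mathrm{Diam}_\infty(\mathcal{R}_N,\theta)N .$$ (ii) If $\xi$ is a non-negative Borel measure on $T$ such that $\theta^\Delta(\xi,x_1,x_2)\le c_0\,\theta(x_1,x_2)$ for all $x_1,x_2\in\mathcal{M}$, with a constant $c_0>0$, then $$\theta^\Delta_N(\xi)\ \ge\ \langle\theta^\Delta(\xi)\rangle N^2-c_0\,\mathrm{Diam}_1(\mathcal{R}_N,\theta)N\ \ge\ \langle\theta^\Delta(\xi)\rangle N^2-c_0\,\mathrm{Diam}_\infty(\mathcal{R}_N,\theta)N$$ and $$\lambda_N(\xi)\ \le\ c_0\,\mathrm{Diam}_1(\mathcal{R}_N,\theta)N\ \le\ c_0\,\mathrm{Diam}_\infty(\mathcal{R}_N,\theta)N .$$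
   Context: Equal-measure partition: a collection $\mathcal{R}_N=\{V_i\}_{i=1}^N$ of measurable subsets of $\mathcal{M}$ with $\mu(\mathcal{M}\setminus\bigcup_iV_i)=0$, $\mu(V_i\cap V_j)=0$ for $i\ne j$, and $\mu(V_i)=N^{-1}$ for all $i$. With $\mathrm{diam}(V,\theta)=\sup\{\theta(y_1,y_2):y_1,y_2\in V\}$: $\mathrm{Diam}_1(\mathcal{R}_N,\theta)=\frac1N\sum_{i=1}^N\mathrm{diam}(V_i,\theta)$ and $\mathrm{Diam}_\infty(\mathcal{R}_N,\theta)=\max_{1\le i\le N}\mathrm{diam}(V_i,\theta)$. For a metric $\rho$: $\rho[\mathcal{D}_N]=\sum_{x_1,x_2\in\mathcal{D}_N}\rho(x_1,x_2)$ for an $N$-point subset $\mathcal{D}_N\subset\mathcal{M}$; $\rho_N=\sup_{\mathcal{D}_N}\rho[\mathcal{D}_N]$ over all $N$-point subsets; $\langle\rho\rangle=\iint_{\mathcal{M}\times\mathcal{M}}\rho\,d\mu\,d\mu$. Set of radii: $T=\{\theta(y_1,y_2):y_1,y_2\in\mathcal{M}\}$. Balls: $B_r(y)=\{x:\theta(x,y)<r\}$. $\theta^\Delta_r(y_1,y_2)=\frac12\mu(B_r(y_1)\Delta B_r(y_2))$ (symmetric difference); $\theta^\Delta(\xi,y_1,y_2)=\int_T\theta^\Delta_r(y_1,y_2)\,d\xi(r)$; $\langle\theta^\Delta(\xi)\rangle=\int_T\iint_{\mathcal{M}\times\mathcal{M}}\theta^\Delta_r(y_1,y_2)\,d\mu(y_1)d\mu(y_2)\,d\xi(r)$;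 $\theta^\Delta_N(\xi)=\sup_{\mathcal{D}_N}\sum_{x_1,x_2\in\mathcal{D}_N}\theta^\Delta(\xi,x_1,x_2)$ over all $N$-point subsets. Discrepancy: $\lambda_r[\mathcal{D}_N]=\int_{\mathcal{M}}\big(\#(B_r(y)\cap\mathcal{D}_N)-N\mu(B_r(y))\big)^2d\mu(y)$, $\lambda[\xi,\mathcal{D}_N]=\int_T\lambda_r[\mathcal{D}_N]\,d\xi(r)$, $\lambda_N(\xi)=\inf_{\mathcal{D}_N}\lambda[\xi,\mathcal{D}_N]$ over all $N$-point subsets. *)

(* Defs.v *)
From HB Require Import structures.
From mathcomp Require Import all_boot all_order all_algebra finmap.
From mathcomp Require Import all_classical all_reals all_analysis.

Set Implicit Arguments.
Unset Strict Implicit.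
Unset Printing Implicit Defensive.

Import Order.TTheory GRing.Theory Num.Theory.
Import numFieldNormedType.Exports.

Local Open Scope classical_set_scope.
Local Open Scope ring_scope.
Local Open Scope ereal_scope.

(* Measurable types are pointed in the library, so the Borel structure needs a
   pointed metric space.  A space carrying a probability measure is nonempty,
   hence this is no restriction. *)
#[short(type="pmetricType")]
HB.structure Definition PointedMetric (R : numDomainType) :=
  {M of Metric R M & Pointed M}.

Definition borel (R : realType) (M : pmetricType R) : measurableType _ :=
  g_sigma_algebraType (@open M).

Section Definitions.
Context {R : realType} {M : pmetricType R}.
Implicit Types (mu : probability (borel M) R) (V : set M) (D : {fset M}).
Implicit Types (xi : {measure set (measurableTypeR R) -> \bar R}).

Record is_metric (rho : M -> M -> R) : Prop := IsMetric {
  is_metric_ge0 : forall x y, (0 <= rho x y)%R;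
  is_metric_eq0 : forall x y, rho x y = 0%R <-> x = y;
  is_metric_sym : forall x y, rho x y = rho y x;
  is_metric_triangle : forall x y z, (rho x z <= rho x y + rho y z)%R }.

Record equal_measure_partition mu (N : nat) (V : 'I_N -> set M) : Prop :=
  EqualMeasurePartition {
  emp_measurable : forall i, measurable (V i : set (borel M));
  emp_cover : mu (~` \bigcup_(i : 'I_N) V i) = 0;
  emp_disjoint : forall i j, i != j -> mu (V i `&` V j) = 0;
  emp_measure : forall i, mu (V i) = (N%:R^-1)%:E }.

Definition diam V : \bar R :=
  ereal_sup [set (mdist p.1 p.2)%:E | p in V `*` V].

Definition Diam1 N (V : 'I_N -> set M) : \bar R :=
  (N%:R^-1)%:E * \sum_(i < N) diam (V i).

Definition DiamInf N (V : 'I_N -> set M) : \bar R :=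
  \big[maxe/-oo]_(i < N) diam (V i).

Definition point_sets (N : nat) : set {fset M} := [set D | #|` D| = N].

Definition pair_sum (f : M -> M -> \bar R) D : \bar R :=
  \sum_(x1 <- D) \sum_(x2 <- D) f x1 x2.

Definition sup_pair_sum (N : nat) (f : M -> M -> \bar R) : \bar R :=
  ereal_sup [set pair_sum f D | D in point_sets N].

Definition average mu (f : M -> M -> \bar R) : \bar R :=
  \int[mu \x mu]_(p in [set: borel M * borel M]) f p.1 p.2.

Definition radii : set R := [set mdist p.1 p.2 | p in [set: M * M]].

Definition thetaD mu (r : R) (y1 y2 : M) : \bar R :=
  (2^-1)%:E * mu (ball y1 r `+` ball y2 r).

(* A Borel measure on the compact set [radii] is represented by a Borel
   measure [xi] on R (e.g. its extension by 0), integrated over [radii] only;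
   the values of [xi] outside [radii] are never used. *)
Definition thetaD_xi mu xi (y1 y2 : M) : \bar R :=
  \int[xi]_(r in radii) thetaD mu r y1 y2.

Definition average_thetaD mu xi : \bar R :=
  \int[xi]_(r in radii) average mu (thetaD mu r).

Definition discrepancy_at mu (r : R) D : \bar R :=
  \int[mu]_(y in [set: borel M])
    ((#|` [fset x in D | x \in (ball (y : M) r : set M)]%fset|%:R
      - #|` D|%:R * fine (mu (ball (y : M) r))) ^+ 2)%:E.

Definition discrepancy mu xi D : \bar R :=
  \int[xi]_(r in radii) discrepancy_at mu r D.

Definition inf_discrepancy mu xi (N : nat) : \bar R :=
  ereal_inf [set discrepancy mu xi D | D in point_sets N].

End Definitions.

Arguments radii {R} M.

(* Main.v *)
(* Replace the parts by pairwise disjoint ones and draw x_i at random from the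
   i-th part, independently.  Since N times the average over the parts is the
   average over the whole space, the expected pair sum of a metric f is
   <f> N^2 minus the N diagonal averages over V_i x V_i, and these are at most
   c0 diam V_i.  A point set doing at least as well as the expectation is found
   by the method of conditional expectations: the law of one x_i at a time is
   replaced by a Dirac mass without decreasing the expectation.

   For the discrepancy, expanding the square gives, for every point set,
     lambda = 2 N sum_i int theta(x_i, y) dmu(y) - <theta> N^2
              - sum_ij theta(x_i, x_j)
   with theta the averaged symmetric-difference metric, so the same selection
   applied to this quadratic functional bounds lambda by c0 sum_i diam V_i.

   Both parts exchange the integrals over the radii and over the space, although
   xi need not be sigma-finite.  Off a sigma-finite set of radii, all the balls
   centred on a dense sequence q agree almost everywhere, and the Lipschitz
   bound makes theta_r(x, q_0) vanish for xi-almost every such r, for each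
   fixed x.  The null set depends on x, but the radii r for which
   int theta_r(q_0, x) dmu(x) > 0 are jumps of the nondecreasing function
   r |-> int mu(B_r(x)) dmu(x), hence countably many, and none is an atom. *)

From HB Require Import structures.
Require Import Defs.
From mathcomp Require Import all_boot all_order all_algebra finmap.
From mathcomp Require Import all_classical all_reals all_analysis.
From mathcomp Require Import measurable_realfun.
From mathcomp Require Import ring lra.

Set Implicit Arguments.
Unset Strict Implicit.
Unset Printing Implicit Defensive.

Import Order.TTheory GRing.Theory Num.Theory.
Import numFieldNormedType.Exports.
Local Open Scope classical_set_scope.
Local Open Scope ring_scope.
Local Open Scope ereal_scope.

(** * Selecting points by conditional expectations *)

Section exists_ge_integral.
Context d (T : measurableType d) (R : realType) (P : probability T R).

Lemma integral_on_full_set (W : set T) (h : T -> \bar R) :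
  measurable W -> P W = 1 -> measurable_fun setT h -> (forall x, 0 <= h x) ->
  \int[P]_(x in W) h x = \int[P]_x h x.
Proof.
move=> mW PW mh h0.
have PC : P (~` W) = 0 by rewrite probability_setC// PW subee.
rewrite -[in RHS](setUv W) ge0_integral_setU//; last 3 first.
- exact: measurableC.
- by rewrite setUv.
- by apply/disj_setPS; rewrite setICr.
rewrite [X in _ + X](_ : _ = 0) ?adde0//.
apply: null_set_integral => //; first exact: measurableC.
exact: measurable_funS mh.
Qed.

(** If [h] stayed below its mean [c] on all of [W], then [c - h] would be positive there with
    integral 0, hence zero almost everywhere, which [P W = 1] forbids. Finding the point in [W] is
    what keeps the selected points in their parts. *)
Lemma exists_ge_integral (W : set T) (h : T -> \bar R) :
  measurable W -> P W = 1 -> measurable_fun setT h -> (forall x, 0 <= h x) ->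
  \int[P]_x h x < +oo -> exists2 x, W x & \int[P]_y h y <= h x.
Proof.
move=> mW PW mh h0 hoo; pose c : \bar R := \int[P]_x h x; rewrite -/c.
have cfin : c \is a fin_num by rewrite ge0_fin_numE// integral_ge0.
apply: contrapT => /forall2NP hlt.
have hc x : W x -> h x < c.
  by move=> Wx; have [//|/negP] := hlt x; rewrite -ltNge.
have mk : measurable_fun W (fun x => c - h x).
  apply: emeasurable_funB; first exact: measurable_cst.
  exact: measurable_funS mh.
have k0 x : W x -> 0 <= c - h x by move=> Wx; rewrite sube_ge0 ?cfin ?orbT//; exact/ltW/hc.
have mhW : measurable_fun W h by exact: measurable_funS mh.
have : \int[P]_(x in W) (h x + (c - h x)) = c.
  transitivity (\int[P]_(x in W) cst c x).
    apply: eq_integral => x; rewrite inE => Wx /=; rewrite addeC subeK//.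
    by rewrite ge0_fin_numE// (lt_trans (hc _ Wx))// ltey_eq cfin.
  by rewrite integral_cst//= PW mule1.
rewrite ge0_integralD// integral_on_full_set// -/c => ck.
have k_0 : \int[P]_(x in W) (c - h x) = 0.
  by move/(congr1 (fun z => z - c)) : ck; rewrite addeC addeK// subee.
have : ae_eq P W (fun x => c - h x) (cst 0).
  apply/ae_eq_integral_abs => //.
  rewrite -[RHS]k_0; apply: eq_integral => x; rewrite inE => Wx.
  by rewrite gee0_abs// k0.
move=> [A [mA A0 WA]].
have : P W <= P A.
  apply: le_measure; rewrite ?inE// => x Wx; apply: WA => /= /(_ Wx) ch.
  by have := hc _ Wx; rewrite -sube_gt0 ch ltxx.
by rewrite /= PW A0 lee_fin ler10.
Qed.

End exists_ge_integral.

(** * Expected energy of independent random points *)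

Section energy.
Context d (T : measurableType d) (R : realType) (I : finType).
Variables (u : T -> \bar R) (v : T * T -> \bar R).
Hypotheses (mu : measurable_fun setT u) (mv : measurable_fun setT v).
Hypotheses (u0 : forall x, 0 <= u x) (v0 : forall p, 0 <= v p).
Variable K : R.
Hypotheses (uK : forall x, u x <= K%:E) (vK : forall p, v p <= K%:E).
Implicit Types (P : I -> probability T R) (k : I) (W : I -> set T).

(** For independent [x_i] of law [P i], this is the expectation of the sum of the [u (x_i)] and of
    the [v (x_i, x_j)] with [i != j]. The diagonal is left out, since [x_i] is not independent of
    itself. *)
Definition energy P : \bar R :=
  \sum_i \int[P i]_x u x +
  \sum_i \sum_(j | j != i) \int[P i]_x \int[P j]_y v (x, y).

Definition update P k (Q : probability T R) : I -> probability T R :=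
  fun i => if i == k then Q else P i.

Definition update_seq P (s : seq I) (x : I -> T) : I -> probability T R :=
  fun i => if i \in s then (\d_(x i) : probability T R) else P i.

(** Collects everything that involves the index [k] in the last bracket, so that the energy is seen
    to be affine in the law [P k]. *)
Lemma sum_pairs_isolate (a : I -> \bar R) (b : I -> I -> \bar R) k :
  \sum_i a i + \sum_i \sum_(j | j != i) b i j =
  (\sum_(i | i != k) a i +
   \sum_(i | i != k) \sum_(j | (j != i) && (j != k)) b i j) +
  (a k + \sum_(j | j != k) (b k j + b j k)).
Proof.
rewrite (bigD1 k)//= [in X in _ + X](bigD1 k)//=.
rewrite [X in _ + (_ + X)](_ : _ =
   \sum_(i | i != k) b i k +
   \sum_(i | i != k) \sum_(j | (j != i) && (j != k)) b i j); last first.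
  rewrite -big_split/=; apply: eq_bigr => i ik.
  by rewrite (bigD1 k)//= eq_sym.
by rewrite [in RHS]big_split/= [X in _ + X]addeA addeACA addeC.
Qed.

Let mv1 x : measurable_fun setT (fun y => v (x, y)).
Proof. exact: measurableT_comp mv _. Qed.

Let mv2 y : measurable_fun setT (fun x => v (x, y)).
Proof. exact: measurableT_comp mv _. Qed.

Let mF (Q : probability T R) : measurable_fun setT (fun x => \int[Q]_y v (x, y)).
Proof. exact: measurable_fun_fubini_tonelli_F. Qed.

Let mG (Q : probability T R) : measurable_fun setT (fun y => \int[Q]_x v (x, y)).
Proof. exact: measurable_fun_fubini_tonelli_G. Qed.

Let integral_le_bound (Q : probability T R) (g : T -> \bar R) :
  measurable_fun setT g -> (forall x, 0 <= g x) -> (forall x, g x <= K%:E) ->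
  \int[Q]_x g x <= K%:E.
Proof.
move=> mg g0 gK; apply: (@le_trans _ _ (\int[Q]_x (cst K%:E) x)).
  by apply: ge0_le_integral => //= x _; exact: le_trans (g0 x) (gK x).
by rewrite integral_cst//= probability_setT mule1.
Qed.

Lemma energy_ltey P : energy P < +oo.
Proof.
apply: lte_add_pinfty.
  apply: lte_sum_pinfty => i _; apply: le_lt_trans (ltey K%:E).
  exact: integral_le_bound.
apply: lte_sum_pinfty => i _; apply: lte_sum_pinfty => j _.
apply: le_lt_trans (ltey K%:E); apply: integral_le_bound => // x.
  exact: integral_ge0.
exact: integral_le_bound.
Qed.

(** As a function of the [k]-th law the energy is the integral of a single function [h], and some
    point of [W] does at least as well as the mean. *)
Lemma energy_update P k (W : set T) : measurable W -> P k W = 1 ->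
  exists2 x, W x & energy P <= energy (update P k \d_x).
Proof.
move=> mW PW.
pose C := \sum_(i | i != k) \int[P i]_x u x +
  \sum_(i | i != k) \sum_(j | (j != i) && (j != k)) \int[P i]_x \int[P j]_y v (x, y).
(* [h x] is the energy once the [k]-th point is frozen at [x]; [C] gathers the terms free of [k]. *)
pose h x := C + (u x + \sum_(j | j != k)
  (\int[P j]_y v (x, y) + \int[P j]_y v (y, x))).
have hE x : energy (update P k \d_x) = h x.
  rewrite /energy /update (sum_pairs_isolate _ _ k) /h /C; congr (_ + _ + (_ + _)).
  - by apply: eq_bigr => i /negbTE ->.
  - by apply: eq_bigr => i /negbTE ->; apply: eq_bigr => j /andP[_ /negbTE ->].
  - by rewrite eqxx integral_dirac// diracT mul1e.
  - apply: eq_bigr => j /negbTE jk; rewrite eqxx jk; congr (_ + _).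
      by rewrite integral_dirac// diracT mul1e.
    by apply: eq_integral => y _; rewrite integral_dirac// diracT mul1e.
have C0 : 0 <= C.
  apply: adde_ge0; first by apply: sume_ge0 => i _; exact: integral_ge0.
  apply: sume_ge0 => i _; apply: sume_ge0 => j _.
  by apply: integral_ge0 => x _; exact: integral_ge0.
have sum0 x j : 0 <= \int[P j]_y v (x, y) + \int[P j]_y v (y, x).
  by apply: adde_ge0; exact: integral_ge0.
have msum j : measurable_fun setT
    (fun x => \int[P j]_y v (x, y) + \int[P j]_y v (y, x)).
  exact: emeasurable_funD.
have msums : measurable_fun setT (fun x =>
    \sum_(j | j != k) (\int[P j]_y v (x, y) + \int[P j]_y v (y, x))).
  by under eq_fun do rewrite -big_filter; exact: emeasurable_sum.
have mh : measurable_fun setT h.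
  apply: emeasurable_funD; first exact: measurable_cst.
  exact: emeasurable_funD.
have h0 x : 0 <= h x.
  by rewrite /h adde_ge0// adde_ge0// sume_ge0.
have intE : \int[P k]_x h x = energy P.
  rewrite /h ge0_integralD//; last 2 first.
  - by move=> x _; rewrite adde_ge0// sume_ge0.
  - exact: emeasurable_funD.
  rewrite /energy (sum_pairs_isolate _ _ k) integral_cst//= probability_setT mule1.
  congr (_ + _); rewrite ge0_integralD//; last by move=> x _; rewrite sume_ge0.
  congr (_ + _); under eq_integral do rewrite -big_filter.
  rewrite -[in RHS]big_filter ge0_integral_sum//; apply: eq_bigr => j _.
  rewrite ge0_integralD//; last 2 first.
  - by move=> x _; exact: integral_ge0.
  - by move=> x _; exact: integral_ge0.
  congr (_ + _); rewrite -(fubini_tonelli (fun p => v (p.2, p.1)))//.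
  by apply: (measurableT_comp mv); exact: measurable_swap.
have [|x Wx hx] := exists_ge_integral mW PW mh h0.
  by rewrite intE energy_ltey.
by exists x => //; rewrite hE -intE.
Qed.

Lemma energy_select P W : (forall i, measurable (W i)) ->
  (forall i, P i (W i) = 1) ->
  exists2 x : I -> T, (forall i, W i (x i)) &
    energy P <= \sum_i u (x i) + \sum_i \sum_(j | j != i) v (x i, x j).
Proof.
move=> mW PW.
have [x Wx Px] : exists2 x : I -> T, (forall i, i \in enum I -> W i (x i)) &
    energy P <= energy (update_seq P (enum I) x).
  (* [P] is generalised in the induction, since each frozen point changes the family of laws. *)
  elim: (enum I) P PW => [|k s IHs] P PW.
    by exists (fun=> point) => //; rewrite (_ : update_seq _ _ _ = P).
  have [x0 Wx0 le0] := energy_update (mW k) (PW k).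
  have [|x Wx lex] := IHs (update P k \d_x0).
    move=> i; rewrite /update; case: eqP => [->|_]; last exact: PW.
    by rewrite /= diracE mem_set.
  (* If [k] recurs in [s], the choice made in the tail wins, in agreement with [update_seq]. *)
  exists (fun i => if i \in s then x i else x0).
    move=> i; rewrite inE; case: ifPn => [si _|_ /orP[/eqP -> //|//]].
    exact: Wx.
  apply: (le_trans le0); apply: (le_trans lex).
  suff -> : update_seq (update P k \d_x0) s x =
      update_seq P (k :: s) (fun i => if i \in s then x i else x0) by [].
  apply/funext => i; rewrite /update_seq inE /update.
  by case: (i \in s); rewrite ?orbT ?orbF.
exists x => [i|]; first by apply: Wx; rewrite mem_enum.
apply: (le_trans Px); rewrite /energy /update_seq.
rewrite le_eqVlt; apply/orP; left; apply/eqP; congr (_ + _).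
  by apply: eq_bigr => i _; rewrite mem_enum integral_dirac// diracT mul1e.
apply: eq_bigr => i _; apply: eq_bigr => j _.
by rewrite !mem_enum integral_dirac// diracT mul1e integral_dirac// diracT mul1e.
Qed.

End energy.

(** Serves both the conditional laws on the parts and the cutting of a radius measure down to a
    sigma-finite piece. *)
Lemma integral_mrestr d (T : measurableType d) (R : realType)
    (mu : {measure set T -> \bar R}) (W : set T) (mW : measurable W)
    (g : T -> \bar R) :
  measurable_fun setT g -> (forall x, 0 <= g x) ->
  \int[mrestr mu mW]_x g x = \int[mu]_(x in W) g x.
Proof.
move=> mg g0; have mWC := measurableC mW.
rewrite -[in LHS](setUv W) ge0_integral_setU//; last 2 first.
- by rewrite setUv.
- by apply/disj_setPS; rewrite setICr.
rewrite [X in _ + X](_ : _ = 0) ?adde0; last first.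
  apply: null_set_integral => //; first exact: measurable_funS mg.
  by rewrite /= /mrestr setICl measure0.
by apply: eq_measure_integral => A mA AW; rewrite /= /mrestr setIidl.
Qed.

(** * Equal-measure parts and their conditional laws *)

Section equal_measure_parts.
Context d (T : measurableType d) (R : realType) (mu : probability T R).

(** The witness is [mu] conditioned on [W], that is, its restriction to [W] multiplied by [c]; it is
    applied with [c = N]. *)
Lemma exists_conditional (W : set T) (c : R) : measurable W -> (0 < c)%R ->
  mu W = c^-1%:E -> exists P : probability T R, P W = 1 /\
    forall g, measurable_fun setT g -> (forall x, 0 <= g x) ->
      \int[P]_x g x = c%:E * \int[mu]_(x in W) g x.
Proof.
move=> mW c0 muW; pose m : {measure set T -> \bar R} := mrestr mu mW.
(* The last argument of [mnormalize] is a fallback law for total mass zero or infinity; here the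
   mass is [c^-1], so the first case applies to neither. *)
have PE A : mnormalize m mu A = mu (A `&` W) * c%:E.
  have mT : m setT = c^-1%:E by rewrite /m/= /mrestr setTI.
  by rewrite /mnormalize mT/= eqe invr_eq0 gt_eqF//= invrK.
exists (mnormalize m mu); split.
  by rewrite /= PE setIid muW -EFinM mulVf ?gt_eqF.
move=> g mg g0; rewrite -(integral_mrestr mu mW)//.
pose c' : {nonneg R} := NngNum (ltW c0).
rewrite -[c%:E]/(c'%:num%:E) -ge0_integral_mscale//.
apply: eq_measure_integral => A mA _; rewrite [LHS]PE.
by rewrite /mscale/= muleC.
Qed.

Variables (N : nat) (V : 'I_N -> set T).
Hypotheses (mV : forall i, measurable (V i))
  (muV : forall i, mu (V i) = N%:R^-1%:E)
  (muVI : forall i j, i != j -> mu (V i `&` V j) = 0).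

(** Removing from each part its null overlaps with the others costs no mass. Disjointness later
    makes the selected points distinct. *)
Lemma exists_disjoint_parts : exists W : 'I_N -> set T,
  [/\ forall i, measurable (W i), forall i, W i `<=` V i,
      forall i j, i != j -> W i `&` W j = set0 &
      forall i, mu (W i) = N%:R^-1%:E].
Proof.
pose U i := \big[setU/set0]_(j | j != i) V j.
have mU i : measurable (U i) by apply: bigsetU_measurable.
have VU0 i : mu (V i `&` U i) = 0.
  suff [] : measurable (U i) /\ mu (V i `&` U i) = 0 by [].
  rewrite /U; elim/big_ind : _ => [|A B [mA A0] [mB B0]|j ji].
  - by split=> //; rewrite setI0 measure0.
  - split; first exact: measurableU.
    rewrite setIUr; apply: null_set_setU => //; exact: measurableI.
  - by split=> //; apply: muVI; rewrite eq_sym.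
exists (fun i => V i `\` U i); split.
- by move=> i; exact: measurableD.
- by move=> i x [].
- move=> i j ij; rewrite -subset0 => x [[Vi _] [_ nU]]; apply: nU.
  by rewrite /U (bigD1 i)//=; left.
- move=> i; rewrite measureD//.
    by rewrite [X in _ - X]VU0 sube0; exact: muV.
  by apply: le_lt_trans (probability_le1 _ (mV i)) _; rewrite ltry.
Qed.

(** The disjoint parts have total mass [N * N^-1 = 1], so their union is a set of full measure. *)
Lemma sum_integral_parts (W : 'I_N -> set T) (g : T -> \bar R) : (0 < N)%N ->
  (forall i, measurable (W i)) -> (forall i j, i != j -> W i `&` W j = set0) ->
  (forall i, mu (W i) = N%:R^-1%:E) ->
  measurable_fun setT g -> (forall x, 0 <= g x) ->
  \sum_i \int[mu]_(x in W i) g x = \int[mu]_x g x.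
Proof.
move=> N0 mW WI muW mg g0; pose U := \big[setU/set0]_(i <- index_enum 'I_N) W i.
have tW : trivIset [set` index_enum 'I_N] W.
  apply/trivIsetP => i j _ _; exact: WI.
have mU : measurable U by exact: bigsetU_measurable.
have muU : mu U = 1.
  rewrite /U measure_semi_additive_ord//; last by apply/trivIsetP => i j _ _; exact: WI.
  transitivity (\sum_(i < N) N%:R^-1%:E : \bar R); first by apply: eq_bigr => i _; exact: muW.
  rewrite sumEFin sumr_const card_ord -[X in X%:E]mulr_natl divff// pnatr_eq0 -lt0n//.
rewrite -(integral_on_full_set mU)// ge0_integral_bigsetU//.
- exact: index_enum_uniq.
- exact: measurable_funS mg.
Qed.

(** For [x_i] drawn from the conditional laws, the [u]-terms have mean [N] times the integral of
    [u], and the full double sum of the means of [v] is [N^2] times its double integral. The energy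
    lacks only the diagonal blocks, each at most [delta i] because both arguments range over [V i].
    The bound [K] keeps the energy finite. *)
Lemma exists_selection (u : T -> \bar R) (v : T * T -> \bar R) (K : R)
    (delta : 'I_N -> R) : (0 < N)%N ->
  measurable_fun setT u -> measurable_fun setT v ->
  (forall x, 0 <= u x <= K%:E) -> (forall p, 0 <= v p <= K%:E) ->
  (forall i x y, V i x -> V i y -> v (x, y) <= (delta i)%:E) ->
  exists2 x : 'I_N -> T, injective x &
    N%:R%:E * \int[mu]_x u x +
      (N%:R ^+ 2)%:E * (\int[mu]_x \int[mu]_y v (x, y)) <=
    \sum_i u (x i) + \sum_i \sum_(j | j != i) v (x i, x j) +
      \sum_i (delta i)%:E.
Proof.
move=> N0 mu_ mv uK vK vdelta.
have u0 x : 0 <= u x by have /andP[] := uK x.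
have v0 p : 0 <= v p by have /andP[] := vK p.
have [W [mW WV WI muW]] := exists_disjoint_parts.
have NR0 : (0 < N%:R :> R)%R by rewrite ltr0n.
have /choice[P PE] i := exists_conditional (mW i) NR0 (muW i).
have PW i : P i (W i) = 1 by have [] := PE i.
have sumP g : measurable_fun setT g -> (forall x, 0 <= g x) ->
    \sum_i \int[P i]_x g x = N%:R%:E * \int[mu]_x g x.
  move=> mg g0; rewrite -(sum_integral_parts N0 mW WI muW)// ge0_sume_distrr.
    by apply: eq_bigr => i _; have [_ ->] := PE i.
  by move=> i _; exact: integral_ge0.
have mF (Q : probability T R) : measurable_fun setT (fun x => \int[Q]_y v (x, y)).
  exact: measurable_fun_fubini_tonelli_F.
have [x Wx Px] := energy_select mu_ mv u0 v0
  (fun x => proj2 (andP (uK x))) (fun p => proj2 (andP (vK p))) mW PW.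
exists x => [i j xij|].
  apply/eqP; apply: contrapT => /negP ij.
  suff : set0 (x i) by [].
  by rewrite -(WI _ _ ij); split=> //; rewrite xij.
apply: le_trans (leeD2r _ Px); rewrite /energy sumP// -addeA leeD2l//.
have -> : (N%:R ^+ 2)%:E * (\int[mu]_x \int[mu]_y v (x, y)) =
    \sum_i \sum_j \int[P i]_x \int[P j]_y v (x, y).
  transitivity (\sum_i \int[P i]_x (N%:R%:E * \int[mu]_y v (x, y))).
    rewrite sumP; last 2 first.
    - exact: measurable_funeM.
    - by move=> x0; apply: mule_ge0; [rewrite lee_fin ltW|exact: integral_ge0].
    rewrite ge0_integralZl//; last first.
    - by move=> x0 _; exact: integral_ge0.
    by rewrite muleA -EFinM expr2.
  apply: eq_bigr => i _; rewrite -ge0_integral_sum//; last first.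
    by move=> j x0 _; exact: integral_ge0.
  apply: eq_integral => x0 _; rewrite sumP//.
  exact: measurableT_comp mv _.
rewrite -big_split/=; apply: lee_sum => i _.
(* The block [j = i] is the one missing from the energy. *)
rewrite (bigD1 i)//= addeC leeD2l//.
have intW := integral_on_full_set (mW i) (PW i).
rewrite -intW//; last by move=> ?; exact: integral_ge0.
have le_delta (g : T -> \bar R) : measurable_fun setT g ->
    (forall z, 0 <= g z) -> (forall z, W i z -> g z <= (delta i)%:E) ->
    \int[P i]_(z in W i) g z <= (delta i)%:E.
  move=> mg g0 gd; rewrite -[leRHS]mule1 -(PW i) -integral_cst//.
  apply: ge0_le_integral => //; first exact: measurable_funS mg.
apply: (le_delta) => // z; first exact: integral_ge0.
move=> Wz; rewrite -intW//; last exact: measurableT_comp mv _.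
apply: (le_delta) => //; first exact: measurableT_comp mv _.
by move=> y Wy; apply: vdelta; exact: WV.
Qed.

End equal_measure_parts.

(** * Separable pseudometrics *)

Section separable_pseudometric.
Context d (T : measurableType d) (R : realType).
Variables (th : T -> T -> R) (q : nat -> T).
Hypotheses (th_sym : forall x y, th x y = th y x)
  (th_triangle : forall x y z, (th x z <= th x y + th y z)%R)
  (measurable_ball : forall x r, measurable [set y | (th x y < r)%R])
  (q_dense : forall x (e : R), (0 < e)%R -> exists n, (th (q n) x < e)%R).

(** An open set of the product is a countable union of rectangles of balls with centres [q n] and
    radii [k.+1%:R^-1], hence lies in the product sigma-algebra. *)
Lemma measurable_open_rectangles (A : set (T * T)) :
  (forall p, A p -> exists2 e : R, (0 < e)%R & forall p' : T * T,
     (th p.1 p'.1 < e)%R -> (th p.2 p'.2 < e)%R -> A p') ->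
  measurable A.
Proof.
move=> openA.
pose B n k := [set y | (th (q n) y < k.+1%:R^-1)%R].
pose F (i : nat * nat * nat) := B i.1.1 i.2 `*` B i.1.2 i.2.
have -> : A = \bigcup_i (if pselect (F i `<=` A) then F i else set0).
  apply/seteqP; split=> [[x y] Axy|p [i _]]; last first.
    by case: pselect => // FA /FA.
  have [e e0 eA] := openA _ Axy.
  (* The radius must be below [e / 2]: a ball containing [x] lies within twice its radius of [x]. *)
  have [k ke] := @ltr_add_invr R 0 (e / 2) (divr_gt0 e0 (ltr0Sn _ 1)).
  rewrite add0r in ke.
  have k0 : (0 < k.+1%:R^-1 :> R)%R by rewrite invr_gt0.
  have [n nx] := q_dense x k0; have [m my] := q_dense y k0.
  suff FA : F (n, m, k) `<=` A.
    by exists (n, m, k) => //; case: pselect => [?|//] /=; split.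
  have tri z y1 y2 : (th y1 y2 <= th z y1 + th z y2)%R by rewrite (th_sym z).
  case=> p1 p2 [/= Bp1 Bp2]; apply: eA => /=.
    by rewrite [e]splitr (le_lt_trans (tri (q n) _ _))// ltrD// (lt_trans _ ke).
  by rewrite [e]splitr (le_lt_trans (tri (q m) _ _))// ltrD// (lt_trans _ ke).
apply: countable_bigcupT_measurable => // i; case: pselect => [?|?] /=; last exact: measurable0.
by apply: measurableX; exact: measurable_ball.
Qed.

(** The sets where [f < r] are open for [th], by the triangle inequality and the Lipschitz bound. *)
Lemma measurable_lipschitz_pseudometric (f : T -> T -> R) (c : R) : (0 < c)%R ->
  (forall x y, f x y = f y x) ->
  (forall x y z, (f x z <= f x y + f y z)%R) ->
  (forall x y, (f x y <= c * th x y)%R) ->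
  measurable_fun setT (fun p : T * T => f p.1 p.2).
Proof.
move=> c0 fs ft fth; move=> mT; apply: (measurability _ (RGenInftyO.measurableE R)) => //.
move=> /= _ [_ [r ->] <-]; rewrite setTI.
apply: measurable_open_rectangles => -[x y]; rewrite /= in_itv/= => fr.
(* Moving one argument by less than this changes [f] by less than [(r - f x y) / 2]. *)
exists ((r - f x y) / (2 * c))%R; first by rewrite divr_gt0 ?mulr_gt0 ?subr_gt0.
move=> [x' y']; rewrite /= in_itv/= !ltr_pdivlMr ?mulr_gt0// => hx hy.
have := ft x' x y'; have := ft x y y'; have := fth x x'; have := fth y y'.
rewrite (fs x' x); lra.
Qed.

End separable_pseudometric.

(** * Stolarsky's identity *)

Section stolarsky.
Context d (T : measurableType d) (R : realType) (mu : probability T R).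

Lemma measurable_bool_set d' (T' : measurableType d') (b : T' -> bool) :
  measurable_fun setT b -> measurable [set x | b x].
Proof. by move=> mb; rewrite -[X in measurable X]setTI; exact: (mb measurableT [set true]). Qed.

Lemma measurable_xor d' (T' : measurableType d') (f g : T' -> bool) :
  measurable_fun setT f -> measurable_fun setT g ->
  measurable_fun setT (fun z => f z (+) g z).
Proof.
move=> mf mg.
rewrite (_ : (fun z => _) = fun z => if f z then ~~ g z else g z).
  by apply: measurable_fun_ifT => //; exact: measurable_neg.
by apply/funext => z; case: (f z).
Qed.

Lemma integral_if (b : T -> bool) (s t : R) : measurable_fun setT b ->
  (0 <= s)%R -> (0 <= t)%R ->
  \int[mu]_x (if b x then s else t)%:E =
  (s * fine (mu [set x | b x]) + t * (1 - fine (mu [set x | b x])))%:E.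
Proof.
move=> mb s0 t0; pose A := [set x | b x].
have mA : measurable A by exact: measurable_bool_set.
have muA : mu A \is a fin_num by rewrite fin_num_measure.
rewrite -(setUv A) ge0_integral_setU//; last 4 first.
- exact: measurableC.
- by rewrite setUv; apply/measurable_EFinP; apply: measurable_fun_ifT.
- by move=> x _; case: ifP.
- by apply/disj_setPS; rewrite setICr.
rewrite EFinD; congr (_ + _).
  rewrite EFinM fineK//; rewrite -[RHS]integral_cst//.
  by apply: eq_integral => x; rewrite inE /A/= => ->.
rewrite EFinM EFinB fineK// -probability_setC// -integral_cst//; last exact: measurableC.
by apply: eq_integral => x; rewrite inE /A/= => /negP/negbTE ->.
Qed.

Variables (a : T -> T -> bool).
Hypothesis ma : measurable_fun setT (fun p : T * T => a p.1 p.2).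

Let m y := fine (mu [set x | a x y]).

(** Reading [a x y] as membership of [y] in the ball about [x], this is half the measure of a
    symmetric difference. Later [a x y] is [th x y < r]. *)
Definition halfdiff x x' : \bar R :=
  (2^-1)%:E * mu [set y | a x y (+) a x' y].

Let ma1 x : measurable_fun setT (a x).
Proof. exact: (measurable_fun_pair2 x ma). Qed.

Let ma2 y : measurable_fun setT (a^~ y).
Proof. exact: (measurable_fun_pair1 y ma). Qed.

Let m_itv y : (0 <= m y <= 1)%R.
Proof.
have mA : measurable [set x | a x y] by exact: measurable_bool_set.
rewrite /m fine_ge0//= -lee_fin fineK ?fin_num_measure//.
exact: probability_le1.
Qed.

(** The probability that a random [x'] disagrees with [x] about [y], that is, the distance from the
    indicator of [a x y] to its mean [m y]. *)
Let phi x y : R := if a x y then (1 - m y)%R else m y.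

Let mm : measurable_fun setT m.
Proof.
have -> : m = fine \o (fun y => \int[mu]_x (if a x y then 1 else 0)%:E).
  by apply/funext => y /=; rewrite integral_if//= mul1r mul0r addr0.
apply: (measurableT_comp (fine_measurable measurableT)).
apply: (measurable_fun_fubini_tonelli_G (fun p => (if a p.1 p.2 then 1 else 0)%:E)).
  by apply/measurable_EFinP/measurable_fun_ifT.
by move=> p; case: ifP.
Qed.

Let mphi : measurable_fun setT (fun p : T * T => phi p.1 p.2).
Proof.
apply: measurable_fun_ifT => //.
  by apply: measurable_funB => //; exact: measurableT_comp.
exact: measurableT_comp.
Qed.

Let phi_ge0 x y : (0 <= phi x y)%R.
Proof. by rewrite /phi; case: ifP; have /andP[] := m_itv y; rewrite ?subr_ge0. Qed.

Lemma halfdiffE x x' : halfdiff x x' =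
  \int[mu]_y (if a x y (+) a x' y then 2^-1 else 0)%:E.
Proof.
rewrite integral_if//; last exact: measurable_xor.
rewrite mul0r addr0 EFinM fineK// fin_num_measure//.
by apply: measurable_bool_set; exact: measurable_xor.
Qed.

Lemma integral_halfdiff x :
  \int[mu]_x' halfdiff x x' = \int[mu]_y (2^-1 * phi x y)%:E.
Proof.
under eq_integral do rewrite halfdiffE.
rewrite (fubini_tonelli (fun p => (if a x p.2 (+) a p.1 p.2 then 2^-1 else 0)%:E)).
- apply: eq_integral => y _ /=.
  pose s b : R := (if b then 2^-1 else 0)%R.
  transitivity (\int[mu]_x' (if a x' y then s (~~ a x y) else s (a x y))%:E).
    by apply: eq_integral => x' _; case: (a x y); case: (a x' y).
  rewrite integral_if//; try by rewrite /s; case: ifP.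
  by rewrite /s /phi -/(m y); case: (a x y) => /=; rewrite mul0r ?addr0 ?add0r.
- apply/measurable_EFinP; apply: measurable_fun_ifT => //.
  by apply: measurable_xor => //; exact: measurableT_comp (ma1 x) measurable_snd.
- by move=> p; case: ifP.
Qed.

(** For fixed [y] and independent [x], [x'], two Bernoulli variables of parameter [m y] disagree
    with probability [2 * m y * (1 - m y)]. *)
Lemma integral2_halfdiff :
  \int[mu]_x \int[mu]_x' halfdiff x x' = \int[mu]_y (m y * (1 - m y))%:E.
Proof.
under eq_integral do rewrite integral_halfdiff.
rewrite (fubini_tonelli (fun p => (2^-1 * phi p.1 p.2)%:E)).
- apply: eq_integral => y _ /=; have /andP[m0 m1] := m_itv y.
  transitivity (\int[mu]_x
    (if a x y then 2^-1 * (1 - m y) else 2^-1 * m y)%:E).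
    by apply: eq_integral => x _; rewrite /phi; case: ifP.
  rewrite integral_if// ?mulr_ge0 ?subr_ge0// -/(m y); congr EFin.
  by field.
- by apply/measurable_EFinP; exact: measurable_funM.
- by move=> p; rewrite lee_fin mulr_ge0.
Qed.

(** With every term written as an integral over [y], the integrands agree pointwise: this is a
    polynomial identity in [m y] and the 0-1 indicators of [a (x i) y]. The form without subtraction
    of integrals lets nonnegative integrals be added freely. *)
Lemma stolarsky (N : nat) (x : 'I_N -> T) :
  \int[mu]_y ((\sum_i (a (x i) y)%:R - N%:R * m y) ^+ 2)%:E +
    ((N%:R ^+ 2)%:E * (\int[mu]_x1 \int[mu]_x2 halfdiff x1 x2) +
     \sum_i \sum_j halfdiff (x i) (x j)) =
  (2 * N%:R)%:E * \sum_i \int[mu]_x' halfdiff (x i) x'.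
Proof.
have mA i : measurable_fun setT (fun y => (a (x i) y)%:R : R).
  rewrite (_ : (fun y => _) = fun y => if a (x i) y then 1 else 0)%R.
    exact: measurable_fun_ifT.
  by apply/funext => y; case: (a _ _).
have mS : measurable_fun setT (fun y => \sum_i (a (x i) y)%:R : R)%R.
  exact: measurable_sum.
pose xr i j y : R := (if a (x i) y (+) a (x j) y then 2^-1 else 0)%R.
have mxr i j : measurable_fun setT (xr i j).
  by apply: measurable_fun_ifT => //; exact: measurable_xor.
have xr0 i j y : (0 <= xr i j y)%R by rewrite /xr; case: ifP.
have -> : \sum_i \sum_j halfdiff (x i) (x j) =
    \int[mu]_y (\sum_i \sum_j xr i j y)%:E.
  transitivity (\int[mu]_y (\sum_i \sum_j (xr i j y)%:E)).
    rewrite ge0_integral_sum//; last 2 first.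
    - by move=> i; apply: emeasurable_sum => j; exact/measurable_EFinP.
    - by move=> i y _; apply: sume_ge0 => j _; rewrite lee_fin.
    apply: eq_bigr => i _; rewrite ge0_integral_sum//; last 2 first.
    - by move=> j; exact/measurable_EFinP.
    - by move=> j y _; rewrite lee_fin.
    by apply: eq_bigr => j _; rewrite halfdiffE.
  by apply: eq_integral => y _; rewrite -sumEFin; apply: eq_bigr => i _; rewrite -sumEFin.
have mphi_ i : measurable_fun setT (phi (x i)).
  exact: (measurable_fun_pair2 (x i) mphi).
have -> : \sum_i \int[mu]_x' halfdiff (x i) x' =
    \int[mu]_y (\sum_i 2^-1 * phi (x i) y)%:E.
  transitivity (\int[mu]_y (\sum_i (2^-1 * phi (x i) y)%:E)).
    rewrite ge0_integral_sum//; last 2 first.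
    - by move=> i; apply/measurable_EFinP; exact: measurable_funM.
    - by move=> i y _; rewrite lee_fin mulr_ge0.
    by apply: eq_bigr => i _; rewrite integral_halfdiff.
  by apply: eq_integral => y _; rewrite -sumEFin.
have mmm : measurable_fun setT (fun y => (m y * (1 - m y))%R).
  by apply: measurable_funM => //; exact: measurable_funB.
have mm0 y : (0 <= m y * (1 - m y))%R.
  by have /andP[m0 m1] := m_itv y; rewrite mulr_ge0// subr_ge0.
have msxr : measurable_fun setT (fun y => (\sum_i \sum_j xr i j y)%R).
  by apply: measurable_sum => i; exact: measurable_sum.
have sxr0 y : (0 <= \sum_i \sum_j xr i j y)%R.
  by apply: sumr_ge0 => i _; apply: sumr_ge0.
have msphi : measurable_fun setT (fun y => (\sum_i 2^-1 * phi (x i) y)%R).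
  by apply: measurable_sum => i; exact: measurable_funM.
have sphi0 y : (0 <= \sum_i 2^-1 * phi (x i) y)%R.
  by apply: sumr_ge0 => i _; rewrite mulr_ge0.
have msq : measurable_fun setT
    (fun y => ((\sum_i (a (x i) y)%:R - N%:R * m y) ^+ 2)%R).
  by apply: measurable_funX; apply: measurable_funB => //; exact: measurable_funM.
rewrite integral2_halfdiff -!ge0_integralZl_EFin ?mulr_ge0 ?exprn_ge0//;
  try exact/measurable_EFinP.
rewrite -!ge0_integralD//.
- apply: eq_integral => y _; rewrite -!EFinM -!EFinD; congr EFin.
  pose A i : R := (a (x i) y)%:R; rewrite -/(A _); pose S := (\sum_i A i)%R.
  have sum_cst (b : R) : (\sum_(i < N) b = N%:R * b)%R.
    by rewrite sumr_const card_ord mulr_natl.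
  (* For 0-1 values, exclusive or is the polynomial [A i + A j - 2 * A i * A j]. *)
  have xrE i j : xr i j y = (2^-1 * (A i + A j - 2 * (A i * A j)))%R.
    by rewrite /xr /A; case: (a _ y); case: (a _ y) => /=; field.
  have phiE i : (2^-1 * phi (x i) y = 2^-1 * (A i + m y - 2 * m y * A i))%R.
    by rewrite /phi /A; case: (a _ y) => /=; field.
  have sum_xr i : (\sum_j xr i j y = 2^-1 * (N%:R * A i + S - 2 * (A i * S)))%R.
    under eq_bigr do rewrite xrE.
    by rewrite -mulr_sumr sumrB big_split/= sum_cst -!mulr_sumr.
  rewrite (eq_bigr _ (fun i _ => sum_xr i)) (eq_bigr _ (fun i _ => phiE i)).
  rewrite -!mulr_sumr !sumrB !big_split/= !sum_cst -!mulr_sumr -mulr_suml.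
  by rewrite -/S; field.
- by move=> y _; rewrite lee_fin sqr_ge0.
- exact/measurable_EFinP.
- by move=> y _; rewrite adde_ge0 ?mule_ge0 ?lee_fin ?exprn_ge0.
- by apply: emeasurable_funD; [apply: measurable_funeM|]; exact/measurable_EFinP.
- by move=> y _; rewrite mule_ge0 ?lee_fin ?exprn_ge0.
- by apply: measurable_funeM; exact/measurable_EFinP.
- by move=> y _; rewrite lee_fin.
- exact/measurable_EFinP.
- by move=> y _; rewrite lee_fin.
- by move=> y _; rewrite lee_fin.
Qed.

End stolarsky.

(** * Balls and a radius measure that need not be sigma-finite *)

Section sigma_finite_part.
Context d d' (X : measurableType d) (Z : measurableType d') (R : realType).
Variables (xi : {measure set X -> \bar R}) (P : probability Z R).
Variables (I : countType) (S : set X) (F : I -> set X).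
Hypotheses (SF : S = \bigcup_i F i) (mF : forall i, measurable (F i))
  (xiF : forall i, xi (F i) < +oo).

(** The restriction of [xi] to [S] is sigma-finite, so the usual Tonelli theorem applies to it. *)
Lemma fubini_tonelli_sigma_finite_part (k : X * Z -> \bar R) :
  measurable_fun setT k -> (forall p, 0 <= k p) ->
  measurable_fun setT (fun z => \int[xi]_(r in S) k (r, z)) /\
  \int[xi]_(r in S) \int[P]_z k (r, z) = \int[P]_z \int[xi]_(r in S) k (r, z).
Proof.
move=> mk k0; have mS : measurable S by rewrite SF; exact: countable_bigcupT_measurable.
pose m : {measure set X -> \bar R} := mrestr xi mS.
have sm : sigma_finite setT m.
  (* Index 0 covers the complement of [S], which is null for the restriction; index [n'.+1] decodes
     [n'] to some [F i], or to the empty set. *)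
  exists (fun n => if n is n'.+1 then oapp F set0 (choice.unpickle n') else ~` S).
    apply/seteqP; split=> [x _|//].
    have [|nSx] := pselect (S x); last by exists 0%N.
    by rewrite SF => -[i _ Fx]; exists (choice.pickle i).+1 => //=; rewrite choice.pickleK.
  case=> [|n]; first by split; [exact: measurableC|rewrite /= /mrestr setICl measure0].
  case: (choice.unpickle n) => [i|] /=; last by rewrite measure0.
  split => //; apply: le_lt_trans (xiF i); rewrite /mrestr le_measure ?inE//.
  exact: measurableI.
pose sfm : {sigma_finite_measure set X -> \bar R} :=
  HB.pack_for (sigma_finite_measure X R) (Measure.sort m)
    (Measure_isSigmaFinite.Build _ _ _ (Measure.sort m) sm).
have intE (g : X -> \bar R) : measurable_fun setT g -> (forall x, 0 <= g x) ->
    \int[xi]_(x in S) g x = \int[sfm]_x g x.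
  by move=> mg g0; rewrite -(integral_mrestr xi mS).
have mk1 z : measurable_fun setT (fun r => k (r, z)).
  exact: measurable_fun_pair1.
have mk2 r : measurable_fun setT (fun z => k (r, z)).
  exact: measurable_fun_pair2.
have mkS : measurable_fun setT (fun r => \int[P]_z k (r, z)).
  exact: measurable_fun_fubini_tonelli_F.
split.
  under eq_fun do rewrite intE//.
  exact: (measurable_fun_fubini_tonelli_G k).
rewrite intE//; last by move=> r; exact: integral_ge0.
rewrite (fubini_tonelli k)//.
by apply: eq_integral => z _; rewrite intE.
Qed.

End sigma_finite_part.
Arguments fubini_tonelli_sigma_finite_part {d d' X Z R} xi P {I S F} SF mF xiF [k].

(** * Symmetric-difference pseudometrics *)

Section halfdiff_pseudometric.
Context d (T : measurableType d) (R : realType) (mu : probability T R).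
Variable a : T -> T -> bool.
Hypothesis ma : measurable_fun setT (fun p : T * T => a p.1 p.2).

Let mx x x' : measurable [set y | a x y (+) a x' y].
Proof.
by apply: measurable_bool_set; apply: measurable_xor; exact: (measurable_fun_pair2 _ ma).
Qed.

Lemma halfdiff_ge0 x x' : 0 <= halfdiff mu a x x'.
Proof. by rewrite mule_ge0. Qed.

Lemma halfdiffxx x : halfdiff mu a x x = 0.
Proof.
rewrite /halfdiff (_ : [set y | _] = set0) ?measure0 ?mule0//.
by apply/seteqP; split=> // y /=; rewrite addbb.
Qed.

Lemma halfdiffC x x' : halfdiff mu a x x' = halfdiff mu a x' x.
Proof. by rewrite /halfdiff; under eq_set do rewrite addbC. Qed.

Lemma halfdiff_triangle y x z :
  halfdiff mu a x z <= halfdiff mu a x y + halfdiff mu a y z.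
Proof.
rewrite /halfdiff -ge0_muleDr// lee_wpmul2l//.
apply: (le_trans _ (measureU2 mu (mx x y) (mx y z))).
apply: le_measure; rewrite ?inE//; first exact: measurableU.
by move=> t /=; case: (a x t); case: (a y t); case: (a z t) => //=; tauto.
Qed.

Lemma halfdiff_fin x x' : halfdiff mu a x x' \is a fin_num.
Proof. by rewrite /halfdiff fin_numM// fin_num_measure. Qed.

End halfdiff_pseudometric.

Section balls.
Context d (T : measurableType d) (R : realType) (mu : probability T R).
Variable th : T -> T -> R.
Hypothesis mth : measurable_fun setT (fun p : T * T => th p.1 p.2).

Definition ball_halfdiff (r : R) := halfdiff mu (fun x y => (th x y < r)%R).

Lemma measurable_in_ball r :
  measurable_fun setT (fun p : T * T => (th p.1 p.2 < r)%R).
Proof. exact: measurable_fun_ltr. Qed.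

(** Joint measurability in the radius and both centres, as Tonelli requires; the value is half the
    measure of a section of a measurable set. *)
Lemma measurable_ball_halfdiff : measurable_fun setT
  (fun p : measurableTypeR R * (T * T) => ball_halfdiff p.1 p.2.1 p.2.2).
Proof.
pose B (f : T * T -> T) (w : (measurableTypeR R * (T * T)) * T) :=
  (th (f w.1.2) w.2 < w.1.1)%R.
have mB f : measurable_fun setT f -> measurable_fun setT (B f).
  move=> mf; apply: measurable_fun_ltr.
    apply: (measurableT_comp (f := fun p : T * T => th p.1 p.2)
      (g := fun w : (measurableTypeR R * (T * T)) * T => (f w.1.2, w.2))) => //.
    apply: measurable_fun_pair => //.
    by apply: measurableT_comp => //; exact: measurableT_comp.
  exact: measurableT_comp.
apply: measurable_funeM.
pose C := [set w | B fst w (+) B snd w].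
have mC : measurable C.
  by apply: measurable_bool_set; apply: measurable_xor; apply: mB.
rewrite (_ : (fun p => _) = mu \o xsection C).
  exact: measurable_fun_xsection.
by apply/funext => p /=; rewrite xsectionE.
Qed.

End balls.

(** * Exchanging the integrals over radii and over the space *)

Section lipschitz_ball_metric.
Context d (T : measurableType d) (R : realType) (mu : probability T R).
Variables (th : T -> T -> R) (q : nat -> T).
Hypotheses (mth : measurable_fun setT (fun p : T * T => th p.1 p.2))
  (th_sym : forall x y, th x y = th y x)
  (th_triangle : forall x y z, (th x z <= th x y + th y z)%R)
  (q_dense : forall x (e : R), (0 < e)%R -> exists n, (th (q n) x < e)%R).
Variables (xi : {measure set (measurableTypeR R) -> \bar R}) (A : set R) (c : R).
Hypotheses (mA : measurable (A : set (measurableTypeR R))) (c0 : (0 < c)%R).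

Let D (r : measurableTypeR R) x x' := ball_halfdiff mu th r x x'.
Let f x x' := \int[xi]_(r in A) D r x x'.
Hypothesis f_le : forall x x', f x x' <= (c * th x x')%:E.

Let mr r : measurable_fun setT (fun p : T * T => (th p.1 p.2 < r)%R).
Proof. exact: measurable_in_ball. Qed.

Let mD : measurable_fun setT (fun p : measurableTypeR R * (T * T) => D p.1 p.2.1 p.2.2).
Proof. exact: measurable_ball_halfdiff. Qed.

Let mD1 x x' : measurable_fun setT (fun r => D r x x').
Proof. exact: (measurable_fun_pair1 (x, x') mD). Qed.

Let mD2 r : measurable_fun setT (fun p : T * T => D r p.1 p.2).
Proof. exact: (measurable_fun_pair2 r mD). Qed.

Let D0 r x x' : 0 <= D r x x'. Proof. exact: halfdiff_ge0. Qed.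

Let DC r x x' : D r x x' = D r x' x. Proof. exact: halfdiffC. Qed.

Let Dtri r y x z : D r x z <= D r x y + D r y z.
Proof. exact: halfdiff_triangle. Qed.

(** [S] will be the sigma-finite part; on the rest, [Z], all balls about the points [q n] agree
    almost everywhere. *)
Let S := \bigcup_n [set r | A r /\ 0 < D r (q 0) (q n)].
Let Z := A `\` S.

Let m_pos x x' : measurable ([set r | A r /\ 0 < D r x x'] : set (measurableTypeR R)).
Proof.
rewrite (_ : [set r | _] = A `&` (fun r => D r x x') @^-1` `]0, +oo[).
  apply: measurableI => //; rewrite -[X in measurable X]setTI.
  by apply: (mD1 x x') => //; exact: emeasurable_itv.
by apply/seteqP; split => r /=; rewrite in_itv/= andbT.
Qed.

Let mS : measurable (S : set (measurableTypeR R)).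
Proof. by apply: bigcupT_measurable => n; exact: m_pos. Qed.

Let mZ : measurable (Z : set (measurableTypeR R)).
Proof. exact: measurableD. Qed.

Let Z_eq0 r n : Z r -> D r (q 0) (q n) = 0.
Proof.
move=> [Ar nS]; apply/eqP; rewrite eq_le D0 andbT leNgt; apply/negP => D_gt0.
by apply: nS; exists n.
Qed.

(** On [Z] the centre [q 0] may be replaced by any [q n], and the Lipschitz bound is small once
    [q n] is near [x]. *)
Let int_Z_q0 x : \int[xi]_(r in Z) D r x (q 0) = 0.
Proof.
apply/eqP; rewrite eq_le integral_ge0// andbT; apply/lee_addgt0Pr => e e0.
have [n nx] := q_dense x (divr_gt0 e0 c0).
rewrite add0e; apply: (@le_trans _ _ (\int[xi]_(r in Z) D r x (q n))).
  apply: ge0_le_integral => //; try exact: measurable_funS (mD1 _ _).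
  move=> r Zr; apply: le_trans (Dtri r (q n) x (q 0)) _.
  by rewrite [D r (q n) _]DC Z_eq0// adde0.
apply: (@le_trans _ _ (f x (q n))).
  apply: ge0_subset_integral => //; first exact: measurable_funS (mD1 _ _).
  exact: subDsetl.
by apply: le_trans (f_le _ _) _; rewrite lee_fin th_sym mulrC -ler_pdivlMr// ltW.
Qed.

Let int_Z x x' : \int[xi]_(r in Z) D r x x' = 0.
Proof.
apply/eqP; rewrite eq_le integral_ge0// andbT.
apply: (@le_trans _ _ (\int[xi]_(r in Z) (D r x (q 0) + D r (q 0) x'))).
  apply: ge0_le_integral => //; try exact: measurable_funS (mD1 _ _).
    by apply: emeasurable_funD; exact: measurable_funS (mD1 _ _).
rewrite ge0_integralD//; try exact: measurable_funS (mD1 _ _).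
by under [X in _ + X]eq_integral do rewrite DC; rewrite !int_Z_q0 adde0.
Qed.

Let B r x := [set y | (th x y < r)%R].

Let mB r x : measurable (B r x).
Proof. exact: measurable_bool_set (measurable_fun_pair2 x (mr r)). Qed.

(* Inside [Z] all the balls around the dense sequence agree almost everywhere,
   and every other ball of that radius is almost contained in them. *)
Let mu_ball_q0 r x : Z r -> mu (B r (q 0)) = mu (B r x) + 2%:E * D r (q 0) x.
Proof.
move=> Zr.
have null n : mu (B r (q n) `\` B r (q 0)) = 0.
  have /eqP := Z_eq0 n Zr; rewrite /D /ball_halfdiff /halfdiff mule_eq0.
  rewrite eqe invr_eq0 pnatr_eq0/= => /eqP.
  apply: subset_measure0; first exact: measurableD.
    by apply: measurable_bool_set; apply: measurable_xor;
      exact: (measurable_fun_pair2 _ (mr r)).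
  by move=> y [/= -> /negP/negbTE ->].
have nullx : mu (B r x `\` B r (q 0)) = 0.
  have : mu (\bigcup_n (B r (q n) `\` B r (q 0))) = 0.
    apply: measure_negligible; first by apply: bigcupT_measurable => n; exact: measurableD.
    apply: negligible_bigcup => n; apply/negligibleP; first exact: measurableD.
    exact: null.
  apply: subset_measure0; first exact: measurableD.
    by apply: bigcupT_measurable => n; exact: measurableD.
  move=> y [/= xy nqy].
  (* A centre [q n] this close to [x] still has [y] in its ball of radius [r]. *)
  have [n nx] : exists n, (th (q n) x < r - th x y)%R.
    by apply: q_dense; rewrite subr_gt0.
  by exists n => //; split=> //=; apply: le_lt_trans (th_triangle _ x _) _; lra.
have -> : 2%:E * D r (q 0) x = mu (B r (q 0) `\` B r x).
  rewrite /D /ball_halfdiff /halfdiff muleA -EFinM divff// mul1e.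
  rewrite -(@measureU0 _ _ _ mu (B r (q 0) `\` B r x) (B r x `\` B r (q 0)))//;
    try exact: measurableD.
  congr (mu _); apply/seteqP; split => y /=; rewrite /B/=.
    by case: (th _ y < r)%R; case: (th _ y < r)%R => //= _; [left|right].
  by case: (th _ y < r)%R; case: (th _ y < r)%R => //= -[[]|[]].
rewrite (measureDI _ (mB r (q 0)) (mB r x)) addeC; congr (_ + _).
rewrite [RHS](measureDI _ (mB r x) (mB r (q 0))) [X in _ = X + _]nullx add0e.
by rewrite setIC.
Qed.

(** For [q n] within [s - r] of [x], the ball of radius [s] about [x] contains the ball of radius
    [r] about [q n], which has the same measure as the one about [q 0]. *)
Let mu_ball_q0_le r s x : Z r -> (r < s)%R -> mu (B r (q 0)) <= mu (B s x).
Proof.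
move=> Zr rs; have [n nx] : exists n, (th (q n) x < s - r)%R.
  by apply: q_dense; rewrite subr_gt0.
rewrite (mu_ball_q0 (q n) Zr) Z_eq0// mule0 adde0.
apply: le_measure; rewrite ?inE// => y; rewrite /B/= => qy.
by apply: le_lt_trans (th_triangle _ (q n) _) _; rewrite th_sym; lra.
Qed.

Let h r := \int[mu]_x D r (q 0) x.
Let G r := \int[mu]_x mu (B r x).

Let mDq r : measurable_fun setT (D r (q 0)).
Proof. exact: (measurable_fun_pair2 (q 0) (mD2 r)). Qed.

Let mmuB r : measurable_fun setT (fun x => mu (B r x)).
Proof.
rewrite (_ : (fun x => _) = mu \o xsection [set p | (th p.1 p.2 < r)%R]).
  by apply: measurable_fun_xsection; exact: measurable_bool_set.
by apply/funext => x /=; rewrite xsectionE.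
Qed.

(** [2 * h r] is the gap between the measure of the ball about [q 0] and the mean ball measure
    [G r]; it is a lower bound for the jump of [G] just after [r]. *)
Let mu_ball_q0E r : Z r -> mu (B r (q 0)) = G r + 2%:E * h r.
Proof.
move=> Zr; have <- : \int[mu]_x mu (B r (q 0)) = mu (B r (q 0)).
  by rewrite integral_cst//= probability_setT mule1.
rewrite -ge0_integralZl// -ge0_integralD//; last 2 first.
- by move=> x _; rewrite mule_ge0.
- exact: measurable_funeM.
by apply: eq_integral => x _; exact: mu_ball_q0.
Qed.

Let m_int x : measurable_fun setT (fun r => \int[mu]_x' D r x x').
Proof.
apply: (measurable_fun_fubini_tonelli_F
  (fun p : measurableTypeR R * T => D p.1 x p.2)) => //.
apply: (measurableT_comp mD (g := fun p : measurableTypeR R * T => (p.1, (x, p.2)))).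
apply: measurable_fun_pair => //; exact: measurable_fun_pair.
Qed.

Let mh : measurable_fun setT h. Proof. exact: m_int. Qed.

Let h0 r : 0 <= h r. Proof. exact: integral_ge0. Qed.

(* [G] is nondecreasing and jumps at every radius of [Z] where [h] is positive,
   so there are countably many such radii, and none of them is an atom of [xi]. *)
Let E (p : rat) := [set r | Z r /\ (G r < (ratr p)%:E < mu (B r (q 0)))].

(** For [r < s] both in [E p], the measure of the ball of radius [r] about [q 0] exceeds [p], yet is
    at most [G s], which is below [p]. *)
Let E_subsingleton p r s : E p r -> E p s -> r = s.
Proof.
wlog rs : r s / (r < s)%R => [hwlog Er Es|].
  have [rs|rs|//] := ltgtP r s; first exact: hwlog.
  by apply/esym; exact: hwlog.
move=> [Zr /andP[_ pr]] [_ /andP[ps _]].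
have : mu (B r (q 0)) <= G s.
  rewrite -[leLHS]mule1 -(probability_setT mu) -integral_cst//.
  by apply: ge0_le_integral => // x _; exact: mu_ball_q0_le.
by move=> /(lt_le_trans pr)/lt_trans/(_ ps); rewrite ltxx.
Qed.

(** At the only radius [r] of [E p], some [D r (q 0) x] is positive. Its product with the mass of
    [r] is at most the integral over [Z], which is 0, so [r] is not an atom. *)
Let xi_E p : measurable (E p : set (measurableTypeR R)) /\ xi (E p) = 0.
Proof.
have [->|/set0P[r Er]] := eqVneq (E p) set0; first by rewrite measure0.
have -> : E p = [set r].
  apply/seteqP; split=> [s Es|s -> //]; exact: E_subsingleton Es Er.
split; first exact: measurable_set1.
have [Zr /andP[Gp pB]] := Er.
have [x Dx] : exists x, 0 < D r (q 0) x.
  apply: contrapT => /forallNP nD; move: (lt_trans Gp pB).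
  rewrite mu_ball_q0E// (_ : h r = 0) ?mule0 ?adde0 ?ltxx//.
  apply: integral0_eq => x _; apply/eqP; rewrite eq_le D0 andbT leNgt.
  exact/negP/nD.
have : \int[xi]_(s in [set r]) D s (q 0) x = 0.
  apply/eqP; rewrite eq_le integral_ge0// andbT -(int_Z (q 0) x).
  apply: ge0_subset_integral => //.
  - exact: measurable_funS (mD1 _ _).
  - by move=> s ->.
rewrite (eq_integral (cst (D r (q 0) x))); last by move=> s; rewrite inE => ->.
rewrite integral_cst//.
by move=> /eqP; rewrite mule_eq0 gt_eqF//= => /eqP.
Qed.

Let int_Z_h : \int[xi]_(r in Z) h r = 0.
Proof.
pose N := \bigcup_p E p.
have mN : measurable (N : set (measurableTypeR R)).
  by apply: bigcupT_measurable_rat => p; have [] := xi_E p.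
have xiN : xi N = 0.
  apply: (measure_negligible mN).
  have -> : N = \bigcup_n oapp E set0 (choice.unpickle n).
    apply/seteqP; split=> [r [p _ Er]|r [n _]].
      by exists (choice.pickle p); [exact: I|rewrite choice.pickleK].
    by case: (choice.unpickle n) => [p Er|//]; exists p.
  apply: negligible_bigcup => n; case: (choice.unpickle n) => [p|] /=.
    by have [mEp xiEp] := xi_E p; apply/negligibleP.
  exact: (negligible_set0 xi).
rewrite (ge0_negligible_integral mN mZ)//; last exact: measurable_funS mh.
apply: integral0_eq => r [Zr nN]; apply/eqP; rewrite eq_le h0 andbT leNgt.
apply/negP => hr; apply: nN.
have G_fin : G r \is a fin_num.
  rewrite ge0_fin_numE ?integral_ge0//.
  apply: (@le_lt_trans _ _ (\int[mu]_x (cst 1) x)).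
    by apply: ge0_le_integral => // x _; apply: probability_le1; exact: mB.
  by rewrite integral_cst//= probability_setT mule1 ltry.
have B_fin : mu (B r (q 0)) \is a fin_num by rewrite fin_num_measure.
have : G r < mu (B r (q 0)) by rewrite mu_ball_q0E// lteDl// mule_gt0.
rewrite -(fineK G_fin) -(fineK B_fin) lte_fin => /rat_in_itvoo[p].
rewrite in_itv/= => /andP[Gp pB]; exists p => //; split=> //.
by rewrite -(fineK G_fin) -(fineK B_fin) !lte_fin Gp.
Qed.

Let int_A (g : R -> \bar R) :
  measurable_fun setT (g : measurableTypeR R -> \bar R) -> (forall r, 0 <= g r) ->
  \int[xi]_(r in A) g r = \int[xi]_(r in S) g r + \int[xi]_(r in Z) g r.
Proof.
move=> mg g0; have SA : S `<=` A by move=> r [n _ []].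
rewrite -[in LHS](setDUK SA) ge0_integral_setU//.
- exact: measurable_funS mg.
- by apply/disj_setPS => r [Sr [_ /(_ Sr)]].
Qed.

Let f_int_S x x' : f x x' = \int[xi]_(r in S) D r x x'.
Proof. by rewrite /f int_A// int_Z adde0. Qed.

(** Markov's inequality, with the Lipschitz bound on [f (q 0) (q n)]. *)
Let xi_S_lty n n' :
  xi [set r | A r /\ n'.+1%:R^-1%:E <= D r (q 0) (q n)] < +oo.
Proof.
have a0 : (0 < n'.+1%:R^-1 :> R)%R by rewrite invr_gt0.
have := le_integral_abse xi mA (measurable_funS measurableT (@subsetT _ _) (mD1 (q 0) (q n))) a0.
rewrite (eq_integral (fun r => D r (q 0) (q n))); last by move=> r _; rewrite gee0_abs.
move=> /le_trans/(_ (f_le _ _)) le_xi; rewrite ltey; apply/eqP => xioo.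
move: le_xi; rewrite (_ : A `&` _ = [set r | A r /\ n'.+1%:R^-1%:E <= D r (q 0) (q n)]).
  by rewrite xioo gt0_muley// leye_eq.
by apply/seteqP; split=> r /=; rewrite gee0_abs.
Qed.

Let m_kernel d' (Y : measurableType d') (u v : Y -> T) :
  measurable_fun setT u -> measurable_fun setT v ->
  measurable_fun setT (fun p : measurableTypeR R * Y => D p.1 (u p.2) (v p.2)).
Proof.
move=> mu_ mv_.
apply: (measurableT_comp mD
  (g := fun p : measurableTypeR R * Y => (p.1, (u p.2, v p.2)))).
by apply: measurable_fun_pair => //; apply: measurable_fun_pair => //;
  exact: measurableT_comp.
Qed.

Let m_intP d' (Y : measurableType d') (P : probability Y R) (u v : Y -> T) :
  measurable_fun setT u -> measurable_fun setT v ->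
  measurable_fun setT (fun r => \int[P]_y D r (u y) (v y)).
Proof.
move=> mu_ mv_; exact: (measurable_fun_fubini_tonelli_F
  (fun p : measurableTypeR R * Y => D p.1 (u p.2) (v p.2)) (m_kernel mu_ mv_)).
Qed.

(** Over [S] this is Tonelli; over [Z] the inner integral of [f] vanishes by [int_Z], and the
    iterated integral vanishes by assumption. The maps [u] and [v] allow one statement for both
    single and double integrals. *)
Let swap d' (Y : measurableType d') (P : probability Y R) (u v : Y -> T) :
  measurable_fun setT u -> measurable_fun setT v ->
  \int[xi]_(r in Z) \int[P]_y D r (u y) (v y) = 0 ->
  measurable_fun setT (fun y => f (u y) (v y)) /\
  \int[xi]_(r in A) \int[P]_y D r (u y) (v y) = \int[P]_y f (u y) (v y).
Proof.
move=> mu_ mv_ intZ.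
(* Thresholds [i.2.+1%:R^-1] split the condition of positivity into countably many sets of finite
   mass. *)
pose F (i : nat * nat) := [set r | A r /\ i.2.+1%:R^-1%:E <= D r (q 0) (q i.1)].
have SF : S = \bigcup_i F i.
  apply/seteqP; split=> [r [n _ [Ar Dr]]|r [i _ [Ar Dr]]]; last first.
    by exists i.1 => //; split=> //; apply: lt_le_trans Dr; rewrite lte_fin invr_gt0.
  have Dfin : D r (q 0) (q n) \is a fin_num by exact: (halfdiff_fin mu (mr r)).
  move: Dr; rewrite -(fineK Dfin) lte_fin => /ltr_add_invr[k]; rewrite add0r => kD.
  by exists (n, k) => //; split=> //=; rewrite -(fineK Dfin) lee_fin ltW.
have mF i : measurable (F i : set (measurableTypeR R)).
  rewrite (_ : F i = A `&` (fun r => D r (q 0) (q i.1)) @^-1` `[i.2.+1%:R^-1%:E, +oo[).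
    apply: measurableI => //; rewrite -[X in measurable X]setTI.
    by apply: (mD1 (q 0) (q i.1)) => //; exact: emeasurable_itv.
  by apply/seteqP; split => r /=; rewrite in_itv/= andbT.
have mk := m_kernel mu_ mv_.
have [mfS intS] := fubini_tonelli_sigma_finite_part xi P SF mF
  (fun i => xi_S_lty i.1 i.2) mk (fun p => D0 _ _ _).
split; first by under eq_fun do rewrite f_int_S; exact: mfS.
rewrite int_A; last 2 first.
- exact: m_intP.
- by move=> r; exact: integral_ge0.
rewrite intZ adde0 intS; apply: eq_integral => y _.
exact/esym/f_int_S.
Qed.

Let mDr r x : measurable_fun setT (D r x).
Proof. exact: (measurable_fun_pair2 x (mD2 r)). Qed.

Let int_D_le r x : \int[mu]_x' D r x x' <= D r x (q 0) + h r.
Proof.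
apply: (@le_trans _ _ (\int[mu]_x' (D r x (q 0) + D r (q 0) x'))).
  apply: ge0_le_integral => //; first exact: emeasurable_funD.
rewrite ge0_integralD// integral_cst//= probability_setT mule1//.
Qed.

(** Through [q 0], the part over [Z] is at most the integral of [D r x (q 0) + h r], and both terms
    integrate to 0. *)
Lemma integral_ball_halfdiff_swap x :
  \int[xi]_(r in A) \int[mu]_x' ball_halfdiff mu th r x x' =
  \int[mu]_x' \int[xi]_(r in A) ball_halfdiff mu th r x x'.
Proof.
have [|_] := @swap _ T mu (cst x) id (measurable_cst x) (@measurable_id _ _ _); last by [].
apply/eqP; rewrite eq_le integral_ge0 ?andbT; last by move=> r _; exact: integral_ge0.
apply: (@le_trans _ _ (\int[xi]_(r in Z) (D r x (q 0) + h r))).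
  apply: ge0_le_integral => //.
  - by move=> r _; exact: integral_ge0.
  - by apply: measurable_funS (m_int x).
  - by apply: emeasurable_funD; [apply: measurable_funS (mD1 _ _)|apply: measurable_funS mh].
  - by move=> r _; exact: int_D_le.
rewrite ge0_integralD//.
- by rewrite int_Z int_Z_h adde0.
- exact: measurable_funS (mD1 _ _).
- exact: measurable_funS mh.
Qed.

Let m_int2 : measurable_fun setT (fun r => \int[mu \x mu]_p D r p.1 p.2).
Proof.
exact: (m_intP (mu \x mu) measurable_fst measurable_snd).
Qed.

Lemma integral2_ball_halfdiff_swap :
  \int[xi]_(r in A) \int[mu \x mu]_p ball_halfdiff mu th r p.1 p.2 =
  \int[mu \x mu]_p \int[xi]_(r in A) ball_halfdiff mu th r p.1 p.2.
Proof.
have [|_] := @swap _ (T * T)%type (mu \x mu) fst snd measurable_fst measurable_snd; last by [].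
apply/eqP; rewrite eq_le integral_ge0 ?andbT; last by move=> r _; exact: integral_ge0.
apply: (@le_trans _ _ (\int[xi]_(r in Z) (h r + h r))).
  apply: ge0_le_integral => //.
  - by move=> r _; exact: integral_ge0.
  - by apply: measurable_funS m_int2.
  - by apply: emeasurable_funD; apply: measurable_funS mh.
  - move=> r Zr; rewrite fubini_tonelli1//.
    apply: (@le_trans _ _ (\int[mu]_x (D r x (q 0) + h r))).
      apply: ge0_le_integral => //.
      + by move=> x _; exact: integral_ge0.
      + exact: (measurable_fun_fubini_tonelli_F _ (mD2 r)).
      + by apply: emeasurable_funD => //; exact: (measurable_fun_pair1 (q 0) (mD2 r)).
      + by move=> x _; exact: int_D_le.
    rewrite ge0_integralD//; last exact: (measurable_fun_pair1 (q 0) (mD2 r)).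
    rewrite integral_cst//= probability_setT mule1.
    by under eq_integral do rewrite DC.
by rewrite ge0_integralD// ?int_Z_h ?adde0//; exact: measurable_funS mh.
Qed.

(** * Stolarsky's identity integrated over the radii *)

Variables (N : nat) (x : 'I_N -> T).

Let dev (r : R) (y : T) : R :=
  (\sum_i ((th (x i) y < r)%R : nat)%:R - N%:R * fine (mu [set z | (th z y < r)%R]))%R.

Let m_dev : measurable_fun setT
  (fun p : measurableTypeR R * T => ((dev p.1 p.2) ^+ 2)%:E).
Proof.
apply/measurable_EFinP; apply: measurable_funX; apply: measurable_funB.
  apply: measurable_sum => i.
  rewrite (_ : (fun p => _) = fun p => if (th (x i) p.2 < p.1)%R then 1%R else 0%R).
    apply: measurable_fun_ifT => //; apply: measurable_fun_ltr => //.
    exact: measurableT_comp (measurable_fun_pair2 (x i) mth) measurable_snd.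
  by apply/funext => p; case: ifP.
apply: measurable_funM => //.
pose C := [set w : (measurableTypeR R * T) * T | (th w.2 w.1.2 < w.1.1)%R].
have mC : measurable C.
  apply: measurable_bool_set; apply: measurable_fun_ltr.
    apply: (measurableT_comp mth
      (g := fun w : (measurableTypeR R * T) * T => (w.2, w.1.2))).
    by apply: measurable_fun_pair => //; exact: measurableT_comp.
  exact: measurableT_comp.
rewrite (_ : (fun p => _) = fine \o (mu \o xsection C)).
  apply: (measurableT_comp (fine_measurable measurableT)).
  exact: measurable_fun_xsection.
by apply/funext => p /=; rewrite xsectionE.
Qed.

(** The identity holds at each radius; the two exchange lemmas then turn the integrated means into
    means of [f]. *)
Lemma integral_stolarsky :
  \int[xi]_(r in A) \int[mu]_y ((dev r y) ^+ 2)%:E +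
    ((N%:R ^+ 2)%:E * (\int[mu \x mu]_p f p.1 p.2) +
     \sum_i \sum_j f (x i) (x j)) =
  (2 * N%:R)%:E * \sum_i \int[mu]_x' f (x i) x'.
Proof.
have -> : \int[mu \x mu]_p f p.1 p.2 = \int[xi]_(r in A) \int[mu \x mu]_p D r p.1 p.2.
  exact/esym/integral2_ball_halfdiff_swap.
have -> : \sum_i \int[mu]_x' f (x i) x' =
    \sum_i \int[xi]_(r in A) \int[mu]_x' D r (x i) x'.
  by apply: eq_bigr => i _; exact/esym/integral_ball_halfdiff_swap.
have mDA x1 x2 : measurable_fun A (fun r => D r x1 x2).
  exact: measurable_funS (mD1 x1 x2).
have m2A : measurable_fun A (fun r => \int[mu \x mu]_p D r p.1 p.2).
  exact: measurable_funS m_int2.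
have m1A x1 : measurable_fun A (fun r => \int[mu]_x' D r x1 x').
  exact: measurable_funS (m_int x1).
have mdevA : measurable_fun A (fun r => \int[mu]_y ((dev r y) ^+ 2)%:E).
  apply: measurable_funS (measurable_fun_fubini_tonelli_F _ m_dev _) => //.
  by move=> p; rewrite lee_fin sqr_ge0.
have -> : \sum_i \sum_j f (x i) (x j) =
    \int[xi]_(r in A) \sum_i \sum_j D r (x i) (x j).
  rewrite ge0_integral_sum//; last 2 first.
  - by move=> i; apply: emeasurable_sum => j; exact: mDA.
  - by move=> i r _; apply: sume_ge0 => j _; exact: D0.
  by apply: eq_bigr => i _; rewrite ge0_integral_sum// => j; exact: mDA.
rewrite -ge0_integral_sum; [|exact: mA|by move=> i; exact: m1A|
  by move=> i r _; exact: integral_ge0].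
have dev0 r : 0 <= \int[mu]_y ((dev r y) ^+ 2)%:E.
  by apply: integral_ge0 => y _; rewrite lee_fin sqr_ge0.
have I2_0 r : 0 <= \int[mu \x mu]_p D r p.1 p.2 by exact: integral_ge0.
have DD0 r : 0 <= \sum_i \sum_j D r (x i) (x j).
  by apply: sume_ge0 => i _; apply: sume_ge0 => j _; exact: D0.
have mDD : measurable_fun A (fun r => \sum_i \sum_j D r (x i) (x j)).
  by apply: emeasurable_sum => i; apply: emeasurable_sum => j; exact: mDA.
have I1_0 r : 0 <= \sum_i \int[mu]_x' D r (x i) x'.
  by apply: sume_ge0 => i _; exact: integral_ge0.
rewrite -ge0_integralZl_EFin; [|exact: mA|by []|by []|by rewrite exprn_ge0].
rewrite -ge0_integralZl_EFin; [|exact: mA|by []| |by rewrite mulr_ge0]; last first.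
  by apply: emeasurable_sum => i; exact: m1A.
rewrite -ge0_integralD; [|exact: mA| | | |]; last 4 first.
- by move=> r _; rewrite mule_ge0// lee_fin exprn_ge0.
- exact: measurable_funeM.
- by [].
- exact: mDD.
rewrite -ge0_integralD; [|exact: mA| | | |]; last 4 first.
- by [].
- exact: mdevA.
- by move=> r _; rewrite adde_ge0// mule_ge0// lee_fin exprn_ge0.
- by apply: emeasurable_funD => //; exact: measurable_funeM.
apply: eq_integral => r _; rewrite fubini_tonelli1; last 2 first.
- exact: mD2.
- by move=> p; exact: D0.
exact: (@stolarsky _ _ _ mu _ (mr r) N x).
Qed.

End lipschitz_ball_metric.

(** * Selection for a bounded kernel *)

Section bounded_selection.
Context d (T : measurableType d) (R : realType) (mu : probability T R).
Variables (N : nat) (V : 'I_N -> set T).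
Hypotheses (N0 : (0 < N)%N) (mV : forall i, measurable (V i))
  (muV : forall i, mu (V i) = N%:R^-1%:E)
  (muVI : forall i j, i != j -> mu (V i `&` V j) = 0).
Variables (g : T -> T -> R) (K : R) (delta : 'I_N -> R).
Hypotheses (mg : measurable_fun setT (fun p : T * T => g p.1 p.2))
  (g0 : forall x y, (0 <= g x y)%R) (gK : forall x y, (g x y <= K)%R)
  (gxx : forall x, g x x = 0%R)
  (gV : forall i x y, V i x -> V i y -> (g x y <= delta i)%R).

Let mgE : measurable_fun setT (fun p : T * T => (g p.1 p.2)%:E).
Proof. exact/measurable_EFinP. Qed.

Let sum_offdiag (x : 'I_N -> T) :
  \sum_i \sum_(j | j != i) (g (x i) (x j))%:E = \sum_i \sum_j (g (x i) (x j))%:E.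
Proof.
by apply: eq_bigr => i _; rewrite [RHS](bigD1 i)//= gxx add0e.
Qed.

Let I2 := \int[mu \x mu]_p (g p.1 p.2)%:E.

Let I2E : I2 = \int[mu]_x \int[mu]_y (g x y)%:E.
Proof. by rewrite /I2 fubini_tonelli1// => p; rewrite lee_fin. Qed.

Let K0 : (0 <= K)%R. Proof. exact: le_trans (g0 point point) (gK point point). Qed.

(** The selection with [u = 0]; the missing diagonal terms vanish since [g x x = 0]. *)
Lemma exists_large_pair_sum : exists2 x : 'I_N -> T, injective x &
  (N%:R ^+ 2)%:E * I2 <=
  \sum_i \sum_j (g (x i) (x j))%:E + \sum_i (delta i)%:E.
Proof.
have uK (x : T) : 0 <= (cst 0 x : \bar R) <= K%:E by rewrite lexx lee_fin.
have vK (p : T * T) : 0 <= (g p.1 p.2)%:E <= K%:E by rewrite !lee_fin g0 gK.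
have vd i x y : V i x -> V i y -> (g x y)%:E <= (delta i)%:E.
  by move=> Vx Vy; rewrite lee_fin gV.
have [x inj_x le_x] := exists_selection mV muV muVI N0 (measurable_cst 0) mgE uK vK vd.
move: le_x; rewrite integral0 mule0 add0e -I2E big1// add0e sum_offdiag => le_x.
by exists x.
Qed.

Let I1 x := \int[mu]_y (g x y)%:E.

Let I1_itv x : 0 <= I1 x <= K%:E.
Proof.
rewrite integral_ge0/=; last by move=> y _; rewrite lee_fin.
apply: (@le_trans _ _ (\int[mu]_y (cst K%:E) y)).
  apply: ge0_le_integral => //.
  - by move=> y _; rewrite lee_fin.
  - exact: (measurable_fun_pair2 x mgE).
  - by move=> y _; rewrite lee_fin.
by rewrite integral_cst//= probability_setT mule1.
Qed.

Let I1_fin x : I1 x \is a fin_num.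
Proof.
by have /andP[I0 IK] := I1_itv x; rewrite ge0_fin_numE// (le_lt_trans IK) ?ltry.
Qed.

Let mI1 : measurable_fun setT I1.
Proof.
apply: (measurable_fun_fubini_tonelli_F (fun p => (g p.1 p.2)%:E)) => // p.
by rewrite lee_fin.
Qed.

Let I2_fin : I2 \is a fin_num.
Proof.
rewrite I2E ge0_fin_numE; last by apply: integral_ge0 => x _; have /andP[] := I1_itv x.
apply: (@le_lt_trans _ _ (\int[mu]_y (cst K%:E) y)).
  apply: ge0_le_integral => //.
  - by move=> x _; have /andP[] := I1_itv x.
  - by move=> x _; have /andP[] := I1_itv x.
by rewrite integral_cst//= probability_setT mule1 ltry.
Qed.

(** Here the pair sum minus [2 * N] times the sum of the [I1 (x i)] is to be large; its mean is
    governed by [N^2 * I2 - 2 * N^2 * I2], which leaves one [N^2 * I2] on the right. *)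
Lemma exists_small_deviation : exists2 x : 'I_N -> T, injective x &
  (2 * N%:R)%:E * \sum_i I1 (x i) <= (N%:R ^+ 2)%:E * I2 +
  \sum_i \sum_j (g (x i) (x j))%:E + \sum_i (delta i)%:E.
Proof.
pose n : R := N%:R; pose i1 x := fine (I1 x).
have i1_itv x : (0 <= i1 x <= K)%R.
  by have := I1_itv x; rewrite -(fineK (I1_fin x)) !lee_fin.
(* The shift by [K] makes the term [- 2 * n * i1 x] nonnegative and cancels at the end. *)
pose u x := (2 * n * (K - i1 x))%:E.
have n0 : (0 <= n)%R by [].
have n2 : (0 <= 2 * n)%R by rewrite mulr_ge0.
have nK : (0 <= 2 * n * K)%R by rewrite mulr_ge0.
have u0 x : 0 <= u x.
  by have /andP[_ iK] := i1_itv x; rewrite lee_fin mulr_ge0 ?subr_ge0.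
have uK x : 0 <= u x <= (2 * n * K + K)%:E.
  have /andP[i0 _] := i1_itv x; rewrite u0 lee_fin.
  rewrite mulrBr (le_trans (y := 2 * n * K)%R)//; first by rewrite gerBl mulr_ge0.
  by rewrite lerDl.
have vK (p : T * T) : 0 <= (g p.1 p.2)%:E <= (2 * n * K + K)%:E.
  by rewrite !lee_fin g0 (le_trans (gK _ _))// lerDr.
have vd i x y : V i x -> V i y -> (g x y)%:E <= (delta i)%:E.
  by move=> Vx Vy; rewrite lee_fin gV.
have mi1 : measurable_fun setT i1.
  exact: (measurableT_comp (fine_measurable measurableT) mI1).
have mu_ : measurable_fun setT u.
  apply/measurable_EFinP; apply: measurable_funM => //.
  exact: measurable_funB.
have int_u : \int[mu]_x u x = (2 * n * (K - fine I2))%:E.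
  have : \int[mu]_x (u x + (2 * n)%:E * I1 x) = (2 * n * K)%:E.
    transitivity (\int[mu]_x (cst (2 * n * K)%:E) x).
      apply: eq_integral => x _; rewrite -(fineK (I1_fin x)) -EFinM -EFinD.
      by congr EFin; rewrite -mulrDr subrK.
    by rewrite integral_cst//= probability_setT mule1.
  rewrite ge0_integralD//; last 2 first.
  - by move=> x _; rewrite mule_ge0//; have /andP[] := I1_itv x.
  - exact: measurable_funeM.
  rewrite ge0_integralZl_EFin//; last by move=> x _; have /andP[] := I1_itv x.
  rewrite -I2E -(fineK I2_fin) -EFinM => /eqP; rewrite eq_sym -sube_eq ?fin_num_adde_defl// => /eqP <-.
  by rewrite -EFinB mulrBr.
have [x inj_x le_x] := exists_selection mV muV muVI N0 mu_ mgE uK vK vd.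
exists x => //; move: le_x; rewrite int_u -I2E sum_offdiag.
have -> : \sum_i I1 (x i) = (\sum_i i1 (x i))%:E.
  by rewrite -sumEFin; apply: eq_bigr => i _; rewrite fineK.
have -> : \sum_i \sum_j (g (x i) (x j))%:E = (\sum_i \sum_j g (x i) (x j))%:E.
  by rewrite -sumEFin; apply: eq_bigr => i _; rewrite sumEFin.
rewrite -(fineK I2_fin).
rewrite !sumEFin -!EFinM -!EFinD !lee_fin.
rewrite -mulr_sumr sumrB sumr_const card_ord -[(K *+ N)%R]mulr_natl -/n.
rewrite /= -!/(n) expr2; nra.
Qed.

End bounded_selection.

(** * Compact metric spaces *)

Section compact_metric.
Context {R : realType} {M : pmetricType R}.
Hypothesis cM : compact [set: M].

(** A compact metric space has a countable base; the sequence takes a point from each of its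
    nonempty members. *)
Lemma exists_dense_sequence : exists q : nat -> M,
  forall x (e : R), (0 < e)%R -> exists n, (mdist (q n) x < e)%R.
Proof.
have [U cU [openU basisU]] := compact_second_countable cM.
have /countable_injP[f finj] := cU.
(* Since [f] is injective on the base, the union has at most one member; [point] is the default when
   there is nothing to choose. *)
exists (fun n => xget point (\bigcup_(A in [set A | U A /\ f A = n]) A)).
move=> x e e0; have [A [UA Ax] Ae] : filter_from [set A | U A /\ A x] id (ball x e).
  exact/basisU/nbhsx_ballx.
exists (f A); case: xgetP => [y _ [A' [UA' fA'] A'y]|/(_ x)[]]; last by exists A.
have AA' : A' = A by apply: finj; rewrite ?inE.
by have := Ae y; rewrite /= -AA' ballEmdist/= metric_sym; exact.
Qed.

Lemma measurable_metric_ball (x : M) (r : R) :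
  measurable ([set y | (mdist x y < r)%R] : set (borel M)).
Proof.
apply: sub_sigma_algebra; rewrite openE => y /= xy.
apply/nbhs_ballP; exists (r - mdist x y)%R; first by rewrite /= subr_gt0.
move=> z; rewrite ballEmdist/= => yz.
by apply: le_lt_trans (metric_triangle _ y _) _; lra.
Qed.

Lemma continuous_mdist : continuous (fun p : M * M => mdist p.1 p.2).
Proof.
move=> [x y]; apply/cvgrPdist_lt => e e0; have e2 : (0 < e / 2)%R by rewrite divr_gt0.
exists (ball x (e / 2), ball y (e / 2)); first by split; exact: nbhsx_ballx.
move=> [x' y'] /=; rewrite !ballEmdist/= => -[xx' yy'].
have := metric_triangle x x' y; have := metric_triangle x' y' y.
have := metric_triangle x' x y'; have := metric_triangle x y y'.
rewrite [mdist y' y]metric_sym [mdist x' x]metric_sym ltr_norml; lra.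
Qed.

Lemma compact_radii : compact (radii M).
Proof.
apply: continuous_compact.
  exact/continuous_subspaceT/continuous_mdist.
rewrite -setXTT; exact: compact_setX.
Qed.

Lemma mdist_bounded : exists K : R, forall x y : M, (mdist x y <= K)%R.
Proof.
have [K [_ KM]] := compact_bounded compact_radii.
exists (K + 1)%R => x y; apply: le_trans (ler_norm _) _.
by apply: KM; [rewrite ltrDl|exists (x, y)].
Qed.

End compact_metric.

(** * From injective families to point sets *)

Section point_set_of_injection.
Context {R : realType} {M : pmetricType R} (mu : probability (borel M) R).
Variables (N : nat) (x : 'I_N -> M).
Hypothesis inj_x : injective x.

Let D : {fset M} := [fset z in codom x]%fset.

Let perm_D : perm_eq D (codom x).
Proof.
apply: uniq_perm; first exact: fset_uniq.
  by rewrite map_inj_uniq// enum_uniq.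
by move=> z; rewrite !inE.
Qed.

Lemma point_sets_codom : point_sets N D.
Proof. by rewrite /point_sets/= (perm_size perm_D) size_codom card_ord. Qed.

Lemma pair_sum_codom (f : M -> M -> \bar R) :
  pair_sum f D = \sum_i \sum_j f (x i) (x j).
Proof.
rewrite /pair_sum (perm_big _ perm_D) big_map big_enum/=.
by apply: eq_bigr => i _; rewrite (perm_big _ perm_D) big_map big_enum.
Qed.

Lemma discrepancy_at_codom (r : R) : discrepancy_at mu r D =
  \int[mu]_y ((\sum_i (mdist (x i) y < r)%R%:R -
     N%:R * fine (mu [set z | (mdist z y < r)%R])) ^+ 2)%:E.
Proof.
apply: eq_integral => y _; congr (_ ^+ 2)%:E.
have -> : #|` D| = N by exact: point_sets_codom.
(* By symmetry of the metric, [x i] lies in the ball about [y] exactly when [y] lies in the ball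
   about [x i]. *)
have -> : ball (y : M) r = [set z | (mdist z y < r)%R].
  by rewrite ballEmdist; apply/funext => z /=; rewrite metric_sym.
congr (_ - _)%R.
rewrite -natr_sum; congr (_%:R)%R.
rewrite (_ : #|` _| = count (fun z => mdist z y < r)%R D); last first.
  rewrite -size_filter; apply/perm_size/uniq_perm.
  - exact: fset_uniq.
  - by rewrite filter_uniq ?fset_uniq.
  - by move=> z; rewrite mem_filter !inE/= andbC; congr (_ && _); apply/idP/idP; rewrite inE.
rewrite (seq.permP perm_D) count_map -sum1_count big_enum_cond/= big_mkcond/=.
by apply: eq_bigr => i _; case: ifP.
Qed.

End point_set_of_injection.

(** * Diameters of the parts *)

Section diameters.
Context {R : realType} {M : pmetricType R}.
Hypothesis cM : compact [set: M].
Variables (mu : probability (borel M) R) (N : nat) (V : 'I_N -> set M).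
Hypothesis muV : equal_measure_partition mu V.

(** With no parts, the uncovered set would be the whole space, of measure 1. *)
Lemma equal_measure_partition_gt0 : (0 < N)%N.
Proof.
case: N V muV => [|//] V' [_ cover _ _].
move: cover; rewrite (_ : \bigcup_i V' i = set0) ?setC0 ?probability_setT.
  by move=> /eqP; rewrite onee_eq0.
by apply/seteqP; split=> // z [[]].
Qed.

(** A part has positive mass, hence a point; the supremum over an empty part would be [-oo]. *)
Lemma diam_ge0 i : 0 <= diam (V i).
Proof.
have [x Vx] : V i !=set0.
  apply/set0P/negP => /eqP V0; have := emp_measure muV i.
  rewrite V0 measure0 => /eqP; rewrite eq_sym eqe invr_eq0 pnatr_eq0.
  by rewrite -leqn0 leqNgt equal_measure_partition_gt0.
by apply: ereal_sup_ubound; exists (x, x) => //=; rewrite mdistxx.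
Qed.

Lemma diam_fin i : diam (V i) \is a fin_num.
Proof.
have [K mK] := mdist_bounded cM.
rewrite ge0_fin_numE ?diam_ge0// (@le_lt_trans _ _ K%:E) ?ltry//.
by apply: ge_ereal_sup => _ [[x y] _ <-]; rewrite lee_fin.
Qed.

Lemma mdist_le_diam i x y : V i x -> V i y -> (mdist x y <= fine (diam (V i)))%R.
Proof.
move=> Vx Vy; rewrite -lee_fin fineK ?diam_fin//.
by apply: ereal_sup_ubound; exists (x, y).
Qed.

Lemma Diam1E : Diam1 V = (N%:R^-1 * \sum_i fine (diam (V i)))%:E.
Proof.
rewrite EFinM -sumEFin; congr (_ * _).
by apply: eq_bigr => i _; rewrite fineK// diam_fin.
Qed.

Let Nn0 : N%:R != 0%R :> R.
Proof. by rewrite pnatr_eq0 -lt0n equal_measure_partition_gt0. Qed.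

Lemma Diam1_le_DiamInf : Diam1 V <= DiamInf V.
Proof.
have le_inf i : (fine (diam (V i)))%:E <= DiamInf V.
  by rewrite fineK ?diam_fin//; exact: le_bigmax.
rewrite Diam1E; case: (DiamInf V) le_inf => [m le_m|_|/(_ (Ordinal equal_measure_partition_gt0))//].
  rewrite lee_fin -[leRHS](mulKf Nn0) ler_wpM2l ?invr_ge0// mulr_natl.
  rewrite -[in leRHS](card_ord N) -sumr_const; apply: ler_sum => i _.
  by rewrite -lee_fin.
exact: leey.
Qed.

Lemma scaled_Diam1 (c : R) :
  c%:E * Diam1 V * N%:R%:E = \sum_i (c * fine (diam (V i)))%:E.
Proof.
rewrite Diam1E sumEFin -!EFinM -mulr_sumr; congr EFin.
by rewrite -mulrA mulrAC mulVf// mul1r.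
Qed.

End diameters.

(** * Bounds for Lipschitz pseudometrics *)

Section lipschitz_pseudometric.
Context {R : realType} {M : pmetricType R}.
Hypothesis cM : compact [set: M].
Variables (mu : probability (borel M) R) (N : nat) (V : 'I_N -> set M).
Hypothesis muV : equal_measure_partition mu V.
Variables (g : M -> M -> R) (c : R).
Hypotheses (c0 : (0 < c)%R) (gxx : forall x, g x x = 0%R)
  (g_sym : forall x y, g x y = g y x)
  (g_triangle : forall x y z, (g x z <= g x y + g y z)%R)
  (g_le : forall x y, (g x y <= c * mdist x y)%R).

Let g0 x y : (0 <= g x y)%R.
Proof. by have := g_triangle x y x; rewrite gxx (g_sym y); lra. Qed.

Lemma measurable_lipschitz : measurable_fun setT
  (fun p : borel M * borel M => g p.1 p.2).
Proof.
have [q q_dense] := exists_dense_sequence cM.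
exact: (measurable_lipschitz_pseudometric (T := borel M) (@metric_sym R M)
  (@metric_triangle R M) (@measurable_metric_ball R M) q_dense c0 g_sym g_triangle g_le).
Qed.

Let delta i := (c * fine (diam (V i)))%R.

Let gV i x y : V i x -> V i y -> (g x y <= delta i)%R.
Proof.
move=> Vx Vy; apply: le_trans (g_le x y) _.
by rewrite ler_pM2l//; exact: (mdist_le_diam cM muV).
Qed.

Lemma lipschitz_bounded : exists K : R, forall x y, (g x y <= K)%R.
Proof.
have [K mK] := mdist_bounded cM.
by exists (c * K)%R => x y; apply: le_trans (g_le x y) _; rewrite ler_pM2l.
Qed.

Lemma average_lipschitz_fin : average mu (fun x y => (g x y)%:E) \is a fin_num.
Proof.
have [K gK] := lipschitz_bounded.
rewrite ge0_fin_numE; last by apply: integral_ge0 => p _; rewrite lee_fin.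
apply: (@le_lt_trans _ _ (\int[mu \x mu]_p (cst K%:E) p)).
  apply: ge0_le_integral => //.
  - by move=> p _; rewrite lee_fin.
  - by apply/measurable_EFinP; exact: measurable_lipschitz.
  - by move=> p _; rewrite lee_fin.
by rewrite integral_cst//= probability_setT mule1 ltry.
Qed.

(** The form for pseudometrics covers both a given metric and the averaged symmetric difference,
    where distinct points may have distance 0. *)
Lemma le_sup_pair_sum_lipschitz :
  average mu (fun x y => (g x y)%:E) * (N%:R ^+ 2)%:E - c%:E * Diam1 V * N%:R%:E
  <= sup_pair_sum N (fun x y => (g x y)%:E).
Proof.
have [K gK] := lipschitz_bounded.
have N0 := equal_measure_partition_gt0 muV.
have [x inj_x le_x] := exists_large_pair_sum N0 (emp_measurable muV)
  (emp_measure muV) (emp_disjoint muV) measurable_lipschitz g0 gK gxx gV.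
rewrite (scaled_Diam1 cM muV) leeBlDr; last by rewrite sumEFin.
rewrite muleC; apply: (le_trans le_x); rewrite leeD2r//.
rewrite -(pair_sum_codom inj_x (fun y z => (g y z)%:E)).
by apply: ereal_sup_ubound; exists [fset z in codom x]%fset => //; exact: point_sets_codom.
Qed.

Lemma exists_small_deviation_lipschitz : exists2 x : 'I_N -> M, injective x &
  (2 * N%:R)%:E * \sum_i \int[mu]_y (g (x i) y)%:E <=
  (N%:R ^+ 2)%:E * average mu (fun x y => (g x y)%:E) +
  \sum_i \sum_j (g (x i) (x j))%:E + c%:E * Diam1 V * N%:R%:E.
Proof.
have [K gK] := lipschitz_bounded.
have N0 := equal_measure_partition_gt0 muV.
rewrite (scaled_Diam1 cM muV).
exact: (exists_small_deviation N0 (emp_measurable muV)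
  (emp_measure muV) (emp_disjoint muV) measurable_lipschitz g0 gK gxx gV).
Qed.

End lipschitz_pseudometric.

(** * The averaged symmetric-difference metric *)

Section averaged_ball_metric.
Context {R : realType} {M : pmetricType R}.
Hypothesis cM : compact [set: M].
Variables (mu : probability (borel M) R).
Variables (xi : {measure set (measurableTypeR R) -> \bar R}) (c : R).
Hypotheses (c0 : (0 < c)%R)
  (theta_le : forall x y, thetaD_xi mu xi x y <= (c * mdist x y)%:E).

Let th : borel M -> borel M -> R := @mdist R M.

Lemma thetaDE r (x y : M) : thetaD mu r x y = ball_halfdiff mu th r x y.
Proof.
rewrite /thetaD /ball_halfdiff /halfdiff !ballEmdist; congr (_ * mu _).
apply/seteqP; split => z /=; rewrite /th.
  by move=> [[-> /negP/negbTE ->]|[-> /negP/negbTE ->]].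
by case: (mdist x z < r)%R; case: (mdist y z < r)%R => //= _; [left|right].
Qed.

Lemma thetaD_xiE (x y : M) :
  thetaD_xi mu xi x y = \int[xi]_(r in radii M) ball_halfdiff mu th r x y.
Proof. by apply: eq_integral => r _; exact: thetaDE. Qed.

Lemma measurable_radii : measurable (radii M : set (measurableTypeR R)).
Proof. exact: (compact_measurable (compact_radii cM)). Qed.

Let mth : measurable_fun setT (fun p : borel M * borel M => th p.1 p.2).
Proof.
apply: (measurable_lipschitz cM ltr01 (@metric_sym R M) (@metric_triangle R M)) => x y.
by rewrite mul1r.
Qed.

Let F_le (x y : borel M) :
  \int[xi]_(r in radii M) ball_halfdiff mu th r x y <= (c * th x y)%:E.
Proof. by rewrite -thetaD_xiE; exact: theta_le. Qed.

Let mball r : measurable_fun setT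
  (fun p : borel M * borel M => (th p.1 p.2 < r)%R).
Proof. exact: measurable_in_ball. Qed.

(** The average is defined with the radius integrated last; the exchange makes it the mean of a
    single Lipschitz pseudometric. *)
Lemma average_thetaDE : average_thetaD mu xi = average mu (thetaD_xi mu xi).
Proof.
have [q q_dense] := exists_dense_sequence cM.
have := integral2_ball_halfdiff_swap mth (@metric_sym R M)
  (@metric_triangle R M) q_dense measurable_radii c0 F_le.
rewrite /average_thetaD /average => swapE.
transitivity (\int[xi]_(r in radii M) \int[mu \x mu]_p ball_halfdiff mu th r p.1 p.2).
  by apply: eq_integral => r _; apply: eq_integral => p _; exact: thetaDE.
by rewrite swapE; apply: eq_integral => p _; rewrite thetaD_xiE.
Qed.

Lemma discrepancy_codom N (x : 'I_N -> M) : injective x ->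
  discrepancy mu xi [fset z in codom x]%fset +
    ((N%:R ^+ 2)%:E * average mu (thetaD_xi mu xi) +
     \sum_i \sum_j thetaD_xi mu xi (x i) (x j)) =
  (2 * N%:R)%:E * \sum_i \int[mu]_y thetaD_xi mu xi (x i) y.
Proof.
move=> inj_x; have [q q_dense] := exists_dense_sequence cM.
have := @integral_stolarsky _ _ _ mu th q mth (@metric_sym R M)
  (@metric_triangle R M) q_dense xi (radii M) c measurable_radii c0 F_le N x.
have thE : thetaD_xi mu xi = fun x y => \int[xi]_(r in radii M) ball_halfdiff mu th r x y.
  by apply/funext => y; apply/funext => z; exact: thetaD_xiE.
rewrite thE => <-; congr (_ + _).
by apply: eq_integral => r _; exact: discrepancy_at_codom.
Qed.

(** A real-valued version, faithful because the Lipschitz bound makes the integral finite. *)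
Definition theta_fine x y : R := fine (thetaD_xi mu xi x y).

Lemma theta_fineK : thetaD_xi mu xi = fun x y => (theta_fine x y)%:E.
Proof.
apply/funext => x; apply/funext => y; rewrite /theta_fine fineK// ge0_fin_numE.
  exact: le_lt_trans (theta_le x y) (ltry _).
by apply: integral_ge0 => r _; rewrite thetaDE; exact: halfdiff_ge0.
Qed.

Lemma theta_finexx x : theta_fine x x = 0%R.
Proof.
rewrite /theta_fine thetaD_xiE integral0_eq// => r _; exact: halfdiffxx.
Qed.

Lemma theta_fineC x y : theta_fine x y = theta_fine y x.
Proof.
rewrite /theta_fine !thetaD_xiE; congr fine.
by apply: eq_integral => r _; exact: halfdiffC.
Qed.

Lemma theta_fine_triangle x y z :
  (theta_fine x z <= theta_fine x y + theta_fine y z)%R.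
Proof.
have fE a b : (theta_fine a b)%:E = thetaD_xi mu xi a b by rewrite theta_fineK.
rewrite -lee_fin EFinD !fE !thetaD_xiE.
have mR := measurable_radii.
have mF a b : measurable_fun (radii M)
    (fun r : measurableTypeR R => ball_halfdiff mu th r a b).
  exact: measurable_funS (measurable_fun_pair1 (a, b) (measurable_ball_halfdiff mu mth)).
have F0 r a b : 0 <= ball_halfdiff mu th r a b by exact: halfdiff_ge0.
rewrite -ge0_integralD; [|exact: mR|by []|exact: mF|by []|exact: mF].
apply: ge0_le_integral => //.
- exact: mF.
- by apply: emeasurable_funD; exact: mF.
- by move=> r _; exact: (halfdiff_triangle mu (mball r)).
Qed.

Lemma theta_fine_le x y : (theta_fine x y <= c * mdist x y)%R.
Proof. by rewrite -lee_fin; have := theta_le x y; rewrite theta_fineK. Qed.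

End averaged_ball_metric.

(** * Bounds for pair sums and discrepancies *)

Unset Implicit Arguments.

Theorem theorem3p2 (R : realType) (M : pmetricType R)
    (M_compact : compact [set: M])
    (mu : probability (borel M) R) (N : nat) (V : 'I_N -> set M)
    (V_partition : equal_measure_partition mu V) :
  (forall (rho : M -> M -> R) (c0 : R),
    is_metric rho -> (0 < c0)%R ->
    (forall x1 x2 : M, (rho x1 x2 <= c0 * mdist x1 x2)%R) ->
    let rhoE := fun x1 x2 : M => (rho x1 x2)%:E in
    average mu rhoE * (N%:R ^+ 2)%:E - c0%:E * Diam1 V * N%:R%:E
      <= sup_pair_sum N rhoE
    /\ average mu rhoE * (N%:R ^+ 2)%:E - c0%:E * DiamInf V * N%:R%:E
      <= average mu rhoE * (N%:R ^+ 2)%:E - c0%:E * Diam1 V * N%:R%:E)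
  /\
  (forall (xi : {measure set (measurableTypeR R) -> \bar R}) (c0 : R),
    (0 < c0)%R ->
    (forall x1 x2 : M, thetaD_xi mu xi x1 x2 <= (c0 * mdist x1 x2)%:E) ->
    [/\ average_thetaD mu xi * (N%:R ^+ 2)%:E - c0%:E * Diam1 V * N%:R%:E
          <= sup_pair_sum N (thetaD_xi mu xi),
        average_thetaD mu xi * (N%:R ^+ 2)%:E - c0%:E * DiamInf V * N%:R%:E
          <= average_thetaD mu xi * (N%:R ^+ 2)%:E
             - c0%:E * Diam1 V * N%:R%:E,
        inf_discrepancy mu xi N <= c0%:E * Diam1 V * N%:R%:E
      & c0%:E * Diam1 V * N%:R%:E <= c0%:E * DiamInf V * N%:R%:E]).
Proof.
have Diam_le (c : R) : (0 < c)%R ->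
    c%:E * Diam1 V * N%:R%:E <= c%:E * DiamInf V * N%:R%:E.
  move=> c0; apply: lee_wpmul2r; first by rewrite lee_fin.
  apply: lee_wpmul2l; first by rewrite lee_fin ltW.
  exact: (Diam1_le_DiamInf M_compact V_partition).
have sub_Diam_le (b : \bar R) (c : R) : (0 < c)%R ->
    b - c%:E * DiamInf V * N%:R%:E <= b - c%:E * Diam1 V * N%:R%:E.
  by move=> c0; rewrite leeD2l// leeN2 Diam_le.
split=> [rho c0 [_ rho_eq0 rho_sym rho_triangle] c0_gt0 rho_le rhoE|xi c0 c0_gt0 theta_le].
  split; last exact: sub_Diam_le.
  apply: (le_sup_pair_sum_lipschitz M_compact V_partition c0_gt0 _ rho_sym _ rho_le) => //.
  by move=> x; apply/rho_eq0.
have gK := theta_fineK theta_le.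
have gxx := theta_finexx mu xi.
have gC := theta_fineC mu xi.
have g_tri := theta_fine_triangle M_compact theta_le.
have g_le := theta_fine_le theta_le.
have avgE := average_thetaDE M_compact c0_gt0 theta_le.
split; [|exact: sub_Diam_le| |exact: Diam_le].
  rewrite avgE gK.
  exact: (le_sup_pair_sum_lipschitz M_compact V_partition c0_gt0 gxx gC g_tri g_le).
have [x inj_x le_x] := exists_small_deviation_lipschitz M_compact V_partition
  c0_gt0 gxx gC g_tri g_le.
apply: (@le_trans _ _ (discrepancy mu xi [fset z in codom x]%fset)).
  by apply: ereal_inf_lbound; exists [fset z in codom x]%fset => //; exact: point_sets_codom.
(* Stolarsky's identity rewrites the left side of [le_x] as the discrepancy plus the same average
   and pair sum that stand on the right; these are finite and cancel. *)
move: le_x; have := discrepancy_codom M_compact c0_gt0 theta_le inj_x.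
rewrite gK => <-; rewrite [leRHS]addeC leeD2rE//.
rewrite fin_numD; apply/andP; split.
  by rewrite fin_numM//; exact: (average_lipschitz_fin M_compact mu c0_gt0 gxx gC g_tri g_le).
by apply/sum_fin_numP => i _ _; apply/sum_fin_numP.
Qed.
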